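(* Let $\{Y(t)\}_{t\ge 0}$ be a Lévy process with Laplace exponent $\psi(\cdot)$. Let $\alpha\in(0,1)$ and $\epsilon>0$, and let $\{S_\alpha^{(\epsilon)}(t)\}_{t\ge0}$ be the InG-$\epsilon$ subordinator, independent of $\{Y(t)\}_{t\ge0}$. Put $Q_\alpha^{(\epsilon)}(t):=Y(S_\alpha^{(\epsilon)}(t))$, $t\ge 0$. Assume that there exist constants $c\in\mathbb{R}$ and $\beta\in(0,1)$ such that $$\frac{\psi(\eta)^{\alpha}}{\eta}\sim c^{\alpha}\eta^{\beta-1}\qquad\text{as } \eta\to 0.$$ Then for any $t\ge 0$, $$\mathbb{P}(Q_\alpha^{(\epsilon)}(t)>x)\sim \frac{c^{\alpha}\,t\,x^{-\beta}}{\Gamma(1-\beta)}\qquad\text{as } x\to\infty.$$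
   Context: The Laplace exponent $\psi$ of a Lévy process $\{Y(t)\}_{t\ge0}$ is defined by $\mathbb{E}[e^{-\eta Y(t)}]=e^{-t\psi(\eta)}$, $\eta>0$. The lower incomplete gamma function is $\gamma(\alpha;\eta)=\int_0^\eta e^{-y}y^{\alpha-1}\,dy$. The InG-$\epsilon$ subordinator $\{S^{(\epsilon)}_\alpha(t)\}_{t\ge0}$, $0<\alpha\le1$, $\epsilon>0$, is the non-decreasing Lévy process with $\mathbb{E}[e^{-\eta S^{(\epsilon)}_\alpha(t)}]=\exp\left(-t\,\frac{\alpha}{\epsilon^{\alpha}}\gamma(\alpha;\eta\epsilon)\right)$, $\eta>0$. The notation $g\sim h$ means that the ratio $g/h$ tends to $1$ in the indicated limit. *)

(* Defs.v *)
From HB Require Import structures.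
From mathcomp Require Import all_boot all_order all_algebra.
From mathcomp Require Import all_classical all_reals all_analysis.

Set Implicit Arguments.
Unset Strict Implicit.
Unset Printing Implicit Defensive.

Import Order.TTheory GRing.Theory Num.Theory.
Import numFieldNormedType.Exports.

Local Open Scope classical_set_scope.
Local Open Scope ring_scope.

(* [g ~ h] along [F]: the ratio [g / h] tends to 1.  The ratio is read as 1
   where both functions vanish, so that [0 ~ 0] holds (e.g. for the law at time
   0).  Where only [h] vanishes, [g x / h x] is 0, so that [g ~ h] fails if this
   happens frequently along [F]. *)
Definition asymp_equiv (R : realType) (F : set_system R) (g h : R -> R) : Prop :=
  (fun x => if (g x == 0) && (h x == 0) then 1 else g x / h x) @ F --> (1 : R).

Definition Gamma (R : realType) (z : R) : R :=
  \int[lebesgue_measure]_(y in `]0, +oo[) (expR (- y) * y `^ (z - 1)).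

Definition lower_incomplete_gamma (R : realType) (a eta : R) : R :=
  \int[lebesgue_measure]_(y in `[0, eta]) (expR (- y) * y `^ (a - 1)).

(* A process indexed by [0, +oo[ is represented by a family indexed by R of
   which only the members at nonnegative times are ever constrained. *)

Definition cadlag (R : realType) (f : R -> R) : Prop :=
  (forall t, 0 <= t -> f @ t^'+ --> f t) /\
  (forall t, 0 < t -> cvg (f @ t^'-)).

Definition increment d (T : measurableType d) (R : realType)
    (P : probability T R) (X : R -> {RV P >-> R}) (s t : R) : T -> R :=
  fun w => X t w - X s w.

(* As each [B i] may be [setT], the product rule over the full family of
   increments contains the product rules over its subfamilies. *)
Definition independent_increments d (T : measurableType d) (R : realType)
    (P : probability T R) (X : R -> {RV P >-> R}) : Prop :=
  forall (n : nat) (t : nat -> R) (B : nat -> set R),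
    0 <= t 0%N -> {homo t : i j / (i <= j)%N >-> i <= j} ->
    (forall i, measurable (B i)) ->
    P (\bigcap_(i in `I_n) (increment X (t i) (t i.+1) @^-1` B i)) =
    (\prod_(i < n) P (increment X (t i) (t i.+1) @^-1` B i))%E.

Definition stationary_increments d (T : measurableType d) (R : realType)
    (P : probability T R) (X : R -> {RV P >-> R}) : Prop :=
  forall (s t : R) (B : set R), 0 <= s -> s <= t -> measurable B ->
    P (increment X s t @^-1` B) = P (X (t - s) @^-1` B).

Definition levy_process d (T : measurableType d) (R : realType)
    (P : probability T R) (X : R -> {RV P >-> R}) : Prop :=
  [/\ {ae P, forall w, X 0 w = 0},
      independent_increments X,
      stationary_increments X &
      {ae P, forall w, cadlag (fun t => X t w)}].

Definition laplace_exponent d (T : measurableType d) (R : realType)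
    (P : probability T R) (X : R -> {RV P >-> R}) (psi : R -> R) : Prop :=
  forall t eta : R, 0 <= t -> 0 < eta ->
    ('E_P[fun w => expR (- (eta * X t w))] = (expR (- (t * psi eta)))%:E)%E.

Definition InG_subordinator d (T : measurableType d) (R : realType)
    (P : probability T R) (alpha eps : R) (S : R -> {RV P >-> R}) : Prop :=
  [/\ levy_process S,
      {ae P, forall w, forall s t : R, 0 <= s -> s <= t -> S s w <= S t w} &
      laplace_exponent S (fun eta =>
        alpha / eps `^ alpha * lower_incomplete_gamma alpha (eta * eps))].

Definition process_sigma_algebra d (T : measurableType d) (R : realType)
    (P : probability T R) (X : R -> {RV P >-> R}) : set (set T) :=
  <<s [set A | exists t : R, exists2 B : set R,
         0 <= t /\ measurable B & A = X t @^-1` B] >>.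

Definition independent_processes d (T : measurableType d) (R : realType)
    (P : probability T R) (X Y : R -> {RV P >-> R}) : Prop :=
  forall A B : set T, process_sigma_algebra X A -> process_sigma_algebra Y B ->
    (P (A `&` B) = P A * P B)%E.

(* Almost sure equality makes [Q t] a random variable although [Y] has cadlag
   paths and [S] has nonnegative values only almost surely. *)
Definition subordinated_process d (T : measurableType d) (R : realType)
    (P : probability T R) (Y S Q : R -> {RV P >-> R}) : Prop :=
  forall t : R, 0 <= t -> {ae P, forall w, Q t w = Y (S t w) w}.

(* Main.v *)
Require Import Defs.
From HB Require Import structures.
From mathcomp Require Import all_boot all_order all_algebra.
From mathcomp Require Import all_classical all_reals all_analysis.
From mathcomp Require Import measurable_realfun ring lra.

(**
Fix t.  Conditioning on S(t) gives E exp(-eta Y(S(t))) = E exp(-psi(eta) S(t)),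
and the InG exponent satisfies (alpha / eps^alpha) gamma(alpha; z eps) ~ z^alpha
at 0, so that 1 - E exp(-eta Q(t)) ~ t psi(eta)^alpha ~ t c^alpha eta^beta; a
Tauberian theorem turns this into the tail of Q(t).

Y may take negative values, so only the positive part of Q(t) is treated: for
eta <= eta0, convexity bounds the contribution of the negative part by
(eta / eta0) E exp(-eta0 Q(t)) = O(eta), which is negligible since beta < 1.
S(t) is approximated from the right by grid-valued times, for which independence
applies cell by cell, and the positive parts pass to the limit by dominated
convergence.

The Tauberian theorem (Karamata) is proved for a nonincreasing G >= 0 whose
Laplace transform is ~ K eta^(b-1), by comparing G with H(y) = K y^(-b) / Gamma(1-b),
which has the same asymptotics.  With u = exp(-eta y), the integral of
u^k (1-u)^n (G - H) is o(eta^(b-1)) for k >= 1 by induction on n, and for n large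
(4u(1-u))^n concentrates around u = 1/2; hence G cannot exceed H (nor H exceed G)
by a fixed factor on a whole window c/eta <= y <= C/eta around ln 2 / eta, and
monotonicity does the rest.
*)

Import Order.TTheory GRing.Theory Num.Theory.
Import numFieldNormedType.Exports.

Set Implicit Arguments.
Unset Strict Implicit.
Unset Printing Implicit Defensive.

Local Open Scope classical_set_scope.
Local Open Scope ring_scope.

(** * Integrals of power functions *)

(** Lebesgue measure is [k] times its image under y -> k y: the two agree on half-open intervals,
    which determine the measure. The formula is then integration against an image measure. *)
Lemma ge0_integral_lebesgue_scale (R : realType) (k : R) (D : set R) (f : R -> \bar R) :
  0 < k -> measurable D -> measurable_fun D f -> (forall y, (0 <= f y)%E) ->
  (\int[lebesgue_measure]_(y in [set y | D (k * y)%R]) f (k * y)%R =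
   (k^-1)%:E * \int[lebesgue_measure]_(y in D) f y)%E.
Proof.
move=> k0 mD mf f0.
pose phi : R -> measurableTypeR R := fun y => k * y.
have mphi : measurable_fun [set: R] phi by exact: mulrl_measurable.
pose phi_mixin := isMeasurableFun.Build _ _ _ _ _ mphi.
pose phi_ : {mfun _ >-> _} := HB.pack phi phi_mixin.
have k0' : 0 <= k by exact: ltW.
have phiE A : measurable A -> (lebesgue_measure A =
    mscale (NngNum k0') (pushforward lebesgue_measure phi_) A)%E.
  move=> mA; apply: lebesgue_measure_unique => //= _ [[a b]] _ <-.
  rewrite /mscale /pushforward /=.
  have pE : phi @^-1` `]a, b]%classic = `]k^-1 * a, k^-1 * b]%classic.
    apply/seteqP; split => y; rewrite /= !in_itv/= /phi => /andP[ay yb].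
      by rewrite ler_pdivlMl// ltr_pdivrMl// ay.
    by move: ay yb; rewrite ler_pdivlMl// ltr_pdivrMl// => -> ->.
  transitivity (k%:E * lebesgue_measure (phi @^-1` `]a, b]%classic))%E => //.
  rewrite pE.
  rewrite !lebesgue_measure_itv/= !lte_fin ltr_pM2l ?invr_gt0//.
  case: ifPn => _; last by rewrite mule0.
  by rewrite -!EFinD -EFinM -mulrBr mulrA divff ?mul1r// gt_eqF.
rewrite [X in _ = (_ * X)%E](eq_measure_integral
  (mscale (NngNum k0') (pushforward lebesgue_measure phi_))); last first.
  by move=> A mA _; exact: phiE.
rewrite ge0_integral_mscale//= muleA -EFinM mulVf ?gt_eqF// mul1e.
by rewrite ge0_integral_pushforward//.
Qed.

Lemma powR_continuous_gt0 (R : realType) (p x : R) :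
  0 < x -> {for x, continuous (fun y : R => y `^ p)}.
Proof.
move=> x0; apply: differentiable_continuous; apply/derivable1_diffP.
by apply: derivable_powR; rewrite in_itv/= x0.
Qed.

Lemma integral_powR_itv_pos (R : realType) (a e x : R) : 0 < a -> 0 < e < x ->
  (\int[lebesgue_measure]_(y in `[e, x]) (y `^ (a - 1))%:E =
   ((x `^ a - e `^ a) / a)%:E)%E.
Proof.
move=> a0 /andP[e0 ex].
have x0 : 0 < x by exact: lt_trans ex.
have cF z : 0 < z -> {for z, continuous (fun y : R => a^-1 * y `^ a)}.
  by move=> z0; apply: continuousM; [exact: cst_continuous|exact: powR_continuous_gt0].
rewrite (@continuous_FTC2 _ _ (fun y => a^-1 * y `^ a)) ?EFinB//.
- by rewrite -EFinB mulrBl !(mulrC a^-1).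
- apply: continuous_in_subspaceT => y; rewrite inE/= in_itv/= => /andP[ey _].
  by apply: powR_continuous_gt0; exact: lt_le_trans ey.
- split.
  + move=> y; rewrite in_itv/= => /andP[ey _]; apply: derivableM => //.
    by apply: derivable_powR; rewrite in_itv/= (lt_trans e0).
  + exact/cvg_at_right_filter/cF.
  + exact/cvg_at_left_filter/cF.
- move=> y; rewrite in_itv/= => /andP[ey _].
  have y0 : 0 < y by exact: lt_trans ey.
  have := is_derive1_powR a y0 => dp.
  have dpa : derivable (fun y : R => y `^ a) y 1.
    by apply: derivable_powR; rewrite in_itv/= y0.
  rewrite derive1E (deriveM _ dpa)//.
  by rewrite derive_cst scaler0 addr0 derive_val /GRing.scale/= mulrA mulVf ?mul1r ?gt_eqF.
Qed.

(** For a < 1 the integrand is unbounded near 0, so the fundamental theorem of calculus is applied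
    from [u n] to [x], and monotone convergence lets [u n] tend to 0. *)
Lemma integral_powR_itv0 (R : realType) (a x : R) : 0 < a -> 0 < x ->
  (\int[lebesgue_measure]_(y in `[0%R, x]) (y `^ (a - 1))%:E = (x `^ a / a)%:E)%E.
Proof.
move=> a0 x0.
have mp (D : set R) : measurable_fun D (fun y : R => (y `^ (a - 1))%:E).
  by apply/measurable_EFinP; apply: measurable_funTS; exact: measurable_powR.
(* The denominators start at 2, which keeps [u n] strictly below [x]. *)
pose u n : R := x / n.+2%:R.
have u0 n : 0 < u n by rewrite divr_gt0.
have ux n : u n < x by rewrite ltr_pdivrMr// ltr_pMr// ltr1n.
have UE : \bigcup_i `[u i, x]%classic = `]0, x]%classic.
  apply/seteqP; split => y /=.
    by move=> [n _] /=; rewrite !in_itv/= => /andP[uy ->]; rewrite (lt_le_trans (u0 n) uy).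
  rewrite in_itv/= => /andP[y0 yx]; exists (Num.truncn (x / y)) => //=.
  rewrite in_itv/= yx andbT /u ler_pdivrMr// mulrC -ler_pdivrMr//.
  by rewrite (le_trans (ltW (truncnS_gt _)))// ler_nat.
have cv : (\int[lebesgue_measure]_(y in `[u i, x]) (y `^ (a - 1))%:E @[i --> \oo] -->
           \int[lebesgue_measure]_(y in \bigcup_i `[u i, x]%classic) (y `^ (a - 1))%:E)%E.
  apply: ge0_nondecreasing_set_cvg_integral => //.
  - move=> m n mn; apply/subsetPset => y /=; rewrite !in_itv/= => /andP[uy ->].
    by rewrite (le_trans _ uy)// ler_pM2l// lef_pV2 ?posrE// ler_nat !ltnS.
  - by move=> i; exact: mp.
  - by move=> i y _; rewrite lee_fin powR_ge0.
rewrite -integral_itv_obnd_cbnd// -UE; apply: (cvg_unique _ cv) => //.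
have -> : (fun i => \int[lebesgue_measure]_(y in `[u i, x]) (y `^ (a - 1))%:E)%E =
    (fun i => ((x `^ a - u i `^ a) / a)%:E).
  by apply/funext => i; rewrite integral_powR_itv_pos ?u0 ?ux.
apply: cvg_EFin; first by apply: nearW.
suff : (x `^ a - u i `^ a) / a @[i --> \oo] --> (x `^ a - 0) / a by rewrite subr0.
apply: cvgMr_tmp; apply: cvgB; first exact: cvg_cst.
have /cvg_at_rightP := powR_cvg0 a0; apply; split => [n|]; first exact: u0.
rewrite -[X in _ --> X](mulr0 x).
apply: cvgMl_tmp.
by have := @cvg_harmonic R; rewrite -cvg_shiftS.
Qed.

(** On the interval of integration exp (-x) <= exp (-y) <= 1; hence gamma(a; x) ~ x^a / a at 0. The
    upper bound also gives the finiteness that [fine] requires. *)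
Lemma lower_incomplete_gamma_bounds (R : realType) (a x : R) : 0 < a -> 0 < x ->
  expR (- x) * (x `^ a / a) <= lower_incomplete_gamma a x <= x `^ a / a.
Proof.
move=> a0 x0.
have mp (D : set R) : measurable_fun D (fun y : R => (y `^ (a - 1))%:E).
  by apply/measurable_EFinP; apply: measurable_funTS; exact: measurable_powR.
have me (D : set R) : measurable_fun D (fun y : R => (expR (- y))).
  by apply: measurable_funTS; apply: measurableT_comp.
have mep (D : set R) : measurable_fun D (fun y : R => (expR (- y) * y `^ (a - 1))%:E).
  by apply/measurable_EFinP; apply: measurable_funM => //; exact/measurable_EFinP.
rewrite /lower_incomplete_gamma /Rintegral.
set I := (X in fine X).
have I1 : (I <= (x `^ a / a)%:E)%E.
  rewrite -integral_powR_itv0//; apply: ge0_le_integral => //.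
  - by move=> y _; rewrite lee_fin mulr_ge0 ?expR_ge0 ?powR_ge0.
  - exact: mep.
  - exact: mp.
  move=> y /=; rewrite in_itv/= => /andP[y0 _].
  by rewrite lee_fin ler_piMl ?powR_ge0// -expR0 ler_expR oppr_le0.
have I2 : ((expR (- x) * (x `^ a / a))%:E <= I)%E.
  rewrite EFinM -integral_powR_itv0// -ge0_integralZl//; last 2 first.
  - exact: mp.
  - by move=> y _; rewrite lee_fin powR_ge0.
  apply: ge0_le_integral => //.
  - by move=> y _; rewrite mule_ge0// lee_fin ?expR_ge0 ?powR_ge0.
  - by apply: measurable_funeM; exact: mp.
  - exact: mep.
  move=> y /=; rewrite in_itv/= => /andP[y0 yx].
  by rewrite -EFinM lee_fin ler_wpM2r ?powR_ge0// ler_expR lerN2.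
have If : I \is a fin_num.
  by rewrite ge0_fin_numE ?(le_lt_trans I1) ?ltry// (le_trans _ I2)// lee_fin mulr_ge0 ?expR_ge0// divr_ge0 ?powR_ge0// ltW.
by rewrite -!lee_fin fineK// I1 I2.
Qed.

Lemma integral_expRN_lty (R : realType) :
  (\int[lebesgue_measure]_(y in `[0%R, +oo[) (expR (- y))%:E < +oo :> \bar R)%E.
Proof.
rewrite (@ge0_continuous_FTC2y _ _ (fun y => - expR (- y)) _ 0) -?EFinB ?ltry//.
- apply: continuous_subspaceT => y; apply: continuous_comp; first exact: opp_continuous.
  exact: continuous_expR.
- by rewrite -oppr0; apply: cvgN; exact: cvgr_expR.
- apply: cvg_at_right_filter; apply: cvgN; apply: continuous_comp; first exact: opp_continuous.
  exact: continuous_expR.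
- move=> y _; rewrite derive1E.
  have ? : is_derive y (1 : R) (fun x : R => expR (- x)) (- expR (- y)).
    by apply: is_derive_eq; rewrite /GRing.scale/=; ring.
  by rewrite deriveN ?derive_val ?opprK//; exact: ex_derive.
Qed.

(** Up to 1 the integrand is dominated by y^(a-1), and beyond 1 by exp (-y) because a <= 1. *)
Lemma Gamma_integrable (R : realType) (a : R) : 0 < a <= 1 ->
  lebesgue_measure.-integrable `]0, +oo[ (fun y : R => (expR (- y) * y `^ (a - 1))%:E).
Proof.
move=> /andP[a0 a1].
have mp (D : set R) : measurable_fun D (fun y : R => (y `^ (a - 1))%:E).
  by apply/measurable_EFinP; apply: measurable_funTS; exact: measurable_powR.
have me (D : set R) : measurable_fun D (fun y : R => (expR (- y))).
  by apply: measurable_funTS; apply: measurableT_comp.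
have mep (D : set R) : measurable_fun D (fun y : R => (expR (- y) * y `^ (a - 1))%:E).
  by apply/measurable_EFinP; apply: measurable_funM => //; exact/measurable_EFinP.
have ep0 (y : R) : (0 <= (expR (- y) * y `^ (a - 1))%:E)%E.
  by rewrite lee_fin mulr_ge0 ?expR_ge0 ?powR_ge0.
apply/integrableP; split; first exact: mep.
under eq_integral do rewrite gee0_abs//.
rewrite (@itv_bndbnd_setU _ _ _ (BRight 1)) ?bnd_simp// ge0_integral_setU//; last 2 first.
  exact: mep.
  by apply/disj_setPS => y /= [/=]; rewrite !in_itv/= andbT => /andP[_ y1]; rewrite ltNge y1.
rewrite lte_add_pinfty//.
  apply: (@le_lt_trans _ _ (\int[lebesgue_measure]_(y in `]0%R, 1%R]) (y `^ (a - 1))%:E)%E).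
    apply: ge0_le_integral => //; [exact: mep|exact: mp|].
    move=> y /=; rewrite in_itv/= => /andP[y0 _].
    by rewrite lee_fin ler_piMl ?powR_ge0// -expR0 ler_expR oppr_le0 ltW.
  by rewrite integral_itv_obnd_cbnd// integral_powR_itv0// ltry.
apply: le_lt_trans (integral_expRN_lty R).
apply: (@le_trans _ _ (\int[lebesgue_measure]_(y in `]1%R, +oo[) (expR (- y))%:E)%E).
  apply: ge0_le_integral => //.
  - exact: mep.
  - apply/measurable_EFinP; exact: me.
  move=> y /=; rewrite in_itv/= andbT => y1.
  rewrite lee_fin ler_piMr ?expR_ge0// -[leRHS](powRr0 y) ler_powR ?(ltW y1) ?subr_le0//.
apply: ge0_subset_integral => //.
- apply/measurable_EFinP; exact: me.
- by apply: subset_itvr; rewrite bnd_simp.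
Qed.

Lemma Gamma_gt0 (R : realType) (a : R) : 0 < a <= 1 -> 0 < Gamma a.
Proof.
move=> a01; have /andP[a0 a1] := a01.
have iG := @Gamma_integrable R a a01; have /integrableP[mG _] := iG.
have iG1 : lebesgue_measure.-integrable `]0%R, 1%R] (fun y : R => (expR (- y) * y `^ (a - 1))%:E).
  by apply: integrableS iG => //; apply: subset_itvl.
apply: (@lt_le_trans _ _ (expR (- 1) * (1 `^ a / a))).
  by rewrite powR1 !mulr_gt0 ?expR_gt0// invr_gt0.
have /andP[+ _] := @lower_incomplete_gamma_bounds _ a 1 a0 ltr01.
move=> /le_trans; apply; rewrite /lower_incomplete_gamma -Rintegral_itv_obnd_cbnd//.
apply: fine_le; [exact: integrable_fin_num|exact: integrable_fin_num|].
apply: ge0_subset_integral => //.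
- by move=> y _; rewrite lee_fin mulr_ge0 ?expR_ge0 ?powR_ge0.
- by apply: subset_itvl.
Qed.

(** Substitution of k y in the Gamma integral. With a = 1 - b this is the transform of the
    comparison function of the Tauberian theorem. *)
Lemma laplace_powR (R : realType) (a k : R) : 0 < a <= 1 -> 0 < k ->
  (\int[lebesgue_measure]_(y in `]0%R, +oo[) (expR (- (k * y)) * y `^ (a - 1))%:E =
   (k `^ (- a) * Gamma a)%:E)%E.
Proof.
move=> a01 k0; have /andP[a0 a1] := a01.
have iG := @Gamma_integrable R a a01; have /integrableP[mG _] := iG.
have ep0 (y : R) : (0 <= (expR (- y) * y `^ (a - 1))%:E)%E.
  by rewrite lee_fin mulr_ge0 ?expR_ge0 ?powR_ge0.
have kS : [set y | `]0, +oo[%classic (k * y)] = `]0%R, +oo[%classic.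
  by apply/seteqP; split => y /=; rewrite !in_itv/= !andbT pmulr_rgt0.
have := @ge0_integral_lebesgue_scale R k `]0, +oo[%classic _ k0 _ mG ep0.
rewrite kS => /(_ (measurable_itv _)) /= kE.
transitivity ((k `^ (1 - a))%:E *
  \int[lebesgue_measure]_(y in `]0%R, +oo[) (expR (- (k * y)) * (k * y) `^ (a - 1))%:E)%E.
  rewrite -ge0_integralZl//.
  - apply: eq_integral => y; rewrite inE/= in_itv/= andbT => y0.
    rewrite -EFinM powRM ?(ltW k0) ?(ltW y0)// mulrCA; congr ((_ * _)%:E).
    rewrite mulrA -powRD; last by rewrite (gt_eqF k0) implybT.
    by rewrite (_ : 1 - a + (a - 1) = 0) ?powRr0 ?mul1r//; ring.
  - apply/measurable_EFinP; apply: measurable_funM.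
      by apply: measurableT_comp => //; apply: measurableT_comp => //; exact: mulrl_measurable.
    apply: (measurableT_comp (@measurable_powR _ _)) => //; exact: mulrl_measurable.
  - by rewrite lee_fin powR_ge0.
rewrite kE muleA -EFinM -(powR_inv1 (ltW k0)) -powRD; last by rewrite (gt_eqF k0) implybT.
rewrite EFinM (_ : 1 - a + -1 = - a); last by ring.
by rewrite /Gamma /Rintegral fineK//; exact: integrable_fin_num.
Qed.

(** * A Tauberian theorem *)

Definition laplace_integrable (R : realType) (H : R -> R) : Prop :=
  forall eta : R, 0 < eta -> lebesgue_measure.-integrable `]0, +oo[
    (fun y : R => (expR (- (eta * y)) * H y)%:E).

Lemma measurable_expRN_scale (R : realType) (eta : R) (D : set R) :
  measurable_fun D (fun y : R => expR (- (eta * y))).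
Proof.
apply: measurable_funTS; apply: measurableT_comp => //.
by apply: measurableT_comp => //; exact: mulrl_measurable.
Qed.

(** One factor u = exp (-eta y) is kept for integrability, whence the exponent [k.+1]; the others
    form a weight u^k (1-u)^n with values in [0, 1]. *)
Lemma laplace_integrable_kernel (R : realType) (H : R -> R) (eta : R) (k n : nat) :
  laplace_integrable H -> 0 < eta ->
  lebesgue_measure.-integrable `]0, +oo[ (fun y : R =>
    (expR (- (eta * y)) ^+ k.+1 * (1 - expR (- (eta * y))) ^+ n * H y)%:E).
Proof.
move=> iH eta0; have iH1 := iH eta eta0; have /integrableP[mH _] := iH1.
pose w (y : R) := expR (- (eta * y)) ^+ k * (1 - expR (- (eta * y))) ^+ n.
have wE : (fun y : R =>
    (expR (- (eta * y)) ^+ k.+1 * (1 - expR (- (eta * y))) ^+ n * H y)%:E) =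
    (fun y => (w y * (expR (- (eta * y)) * H y))%:E).
  by apply/funext => y; rewrite /w exprS; congr EFin; ring.
rewrite wE; apply: le_integrable iH1 => //.
  apply/measurable_EFinP; apply: measurable_funM; last exact/measurable_EFinP.
  apply: measurable_funM; apply: measurable_funX => //.
    exact: measurable_expRN_scale.
  by apply: measurable_funB => //; exact: measurable_expRN_scale.
move=> y /=; rewrite in_itv/= andbT => y0; rewrite lee_fin.
rewrite [leLHS]normrM ler_piMl//.
have u1 : expR (- (eta * y)) <= 1 by rewrite -expR0 ler_expR oppr_le0 mulr_ge0// ltW.
have u0 : 0 <= expR (- (eta * y)) by exact: expR_ge0.
rewrite ger0_norm /w; last by rewrite mulr_ge0 ?exprn_ge0// subr_ge0.
by rewrite mulr_ile1 ?exprn_ge0 ?exprn_ile1 ?subr_ge0// lerBlDr lerDl.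
Qed.

Lemma cvg_at_right0_scale (R : realType) (c l : R) (f : R -> R) : 0 < c ->
  f x @[x --> 0^'+] --> l -> f (c * x) @[x --> 0^'+] --> l.
Proof.
move=> c0 /cvg_at_rightP fl; apply/cvg_at_rightP => u [u0 ucvg].
apply: (fl (fun n => c * u n)); split => [n|]; first by rewrite mulr_gt0.
by rewrite -[X in _ --> X](mulr0 c); apply: cvgMl_tmp.
Qed.

(** For n = 0 the kernel u^(k+1) is the exponential at (k+1) eta, and rescaling costs the constant
    (k+1)^(-s). The step uses u^(k+1) (1-u)^(n+1) = u^(k+1) (1-u)^n - u^(k+2) (1-u)^n, so the
    induction runs over all k at once. *)
Lemma laplace_kernel_cvg0 (R : realType) (H : R -> R) (s : R) (n k : nat) :
  laplace_integrable H ->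
  eta `^ s * \int[lebesgue_measure]_(y in `]0, +oo[) (expR (- (eta * y)) * H y)
    @[eta --> 0^'+] --> (0 : R) ->
  eta `^ s * \int[lebesgue_measure]_(y in `]0, +oo[)
     (expR (- (eta * y)) ^+ k.+1 * (1 - expR (- (eta * y))) ^+ n * H y)
    @[eta --> 0^'+] --> (0 : R).
Proof.
move=> iH H0; elim: n k => [k|n ih k].
  have k0 : 0 < k.+1%:R :> R by [].
  have := cvg_at_right0_scale k0 H0.
  move=> /(cvgMl_tmp (a := k.+1%:R `^ (- s))); rewrite mulr0.
  apply: cvg_trans; apply: near_eq_cvg; near=> eta.
  have eta0 : 0 < eta by near: eta; exact: nbhs_right_gt.
  rewrite powRM ?ler0n ?(ltW eta0)// !mulrA -powRD; last by rewrite pnatr_eq0 implybT.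
  rewrite addNr powRr0 mul1r; congr (_ * _); apply: eq_Rintegral => y _.
  by rewrite expr0 mulr1 -expRM_natl; congr (expR _ * _); ring.
pose F j (eta : R) := eta `^ s * \int[lebesgue_measure]_(y in `]0, +oo[)
     (expR (- (eta * y)) ^+ j.+1 * (1 - expR (- (eta * y))) ^+ n * H y).
have cB : F k eta - F k.+1 eta @[eta --> 0^'+] --> (0 : R).
  by rewrite -[X in _ --> X](subrr 0); apply: cvgB; exact: ih.
apply: cvg_trans cB; apply: near_eq_cvg; near=> eta.
have eta0 : 0 < eta by near: eta; exact: nbhs_right_gt.
rewrite /F -mulrBr -RintegralB//; try exact: laplace_integrable_kernel.
congr (_ * _); apply: eq_Rintegral => y _; rewrite !exprS; ring.
Unshelve. all: by end_near. Qed.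

(** The quantity 4u(1-u) = 1 - (2u-1)^2 is at least 1 - (rho/2)^2 on the inner range singled out by
    [I], and at most 1 - rho^2 outside the window. In the window but off [I], only the sign of h1 -
    h2 matters. *)
Lemma window_kernel_ge (R : realFieldType) (N : nat) (rho c u h1 h2 : R) (I : bool) :
  0 < rho < 1 -> 0 <= c -> 0 <= u <= 1 -> 0 <= h1 -> 0 <= h2 ->
  (I -> (1 - rho / 2) / 2 <= u <= 1 / 2) ->
  ((1 - rho) / 2 <= u <= (1 + rho) / 2 -> c <= h1 - h2) ->
  c * (1 - (rho / 2) ^+ 2) ^+ N.+1 * I%:R - 4 * (1 - rho ^+ 2) ^+ N * (u * h2) <=
  (4 * u * (1 - u)) ^+ N.+1 * (h1 - h2).
Proof.
move=> /andP[rho0 rho1] c0 /andP[u0 u1] h10 h20 Iu cin.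
have q0 : 0 <= 4 * u * (1 - u) by rewrite mulr_ge0 ?subr_ge0// mulr_ge0.
have th0 : 0 <= 1 - rho ^+ 2 by nra.
have th'0 : 0 <= 1 - (rho / 2) ^+ 2 by nra.
have uH : 0 <= 4 * (1 - rho ^+ 2) ^+ N * (u * h2).
  apply: mulr_ge0; last exact: mulr_ge0.
  by apply: mulr_ge0 => //; exact: exprn_ge0.
have [uin|uout] := boolP ((1 - rho) / 2 <= u <= (1 + rho) / 2).
  have hC := cin uin.
  case: I Iu => [/(_ isT) /andP[y1 y2]|_]; last first.
    rewrite mulr0 sub0r (@le_trans _ _ 0) ?oppr_le0//.
    by apply: mulr_ge0; [exact: exprn_ge0|exact: le_trans hC].
  rewrite mulr1 (@le_trans _ _ (c * (1 - (rho / 2) ^+ 2) ^+ N.+1)) ?gerBl//.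
  rewrite mulrC; apply: ler_pM => //; first exact: exprn_ge0.
  by apply: lerXn2r => //; nra.
have -> : I = false.
  apply/negP => /Iu /andP[y1 y2]; move/negP: uout; apply.
  by apply/andP; split; lra.
(* Outside the window [N] of the factors are bounded by 1 - rho^2 and the last one by 4u, which
   retains the factor u that makes u h2 integrable. *)
rewrite mulr0 sub0r lerNl -mulrN opprB.
apply: (@le_trans _ _ ((4 * u * (1 - u)) ^+ N.+1 * h2)).
  by apply: ler_wpM2l; [exact: exprn_ge0|rewrite gerBl].
rewrite mulrA; apply: ler_wpM2r => //; rewrite exprSr.
rewrite (_ : 4 * _ ^+ N * u = (1 - rho ^+ 2) ^+ N * (4 * u)); last by ring.
apply: ler_pM => //; first exact: exprn_ge0; last first.
  by nra.
apply: lerXn2r => //.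
by move: uout; rewrite negb_and -!ltNge => /orP[] h; nra.
Qed.

(* The kernel [(4u(1-u))^N], u = exp(-eta y), singles out the window around [u = 1/2]. *)
Lemma tauberian_window (R : realType) (H1 H2 : R -> R) (s K C rho : R) :
  laplace_integrable H1 -> laplace_integrable H2 ->
  (forall y, 0 < y -> 0 <= H1 y) -> (forall y, 0 < y -> 0 <= H2 y) ->
  eta `^ s * \int[lebesgue_measure]_(y in `]0, +oo[) (expR (- (eta * y)) * H1 y)
    @[eta --> 0^'+] --> K ->
  eta `^ s * \int[lebesgue_measure]_(y in `]0, +oo[) (expR (- (eta * y)) * H2 y)
    @[eta --> 0^'+] --> K ->
  0 < C -> 0 < rho < 1 ->
  \forall eta \near 0^'+, exists y, [/\ 0 < y,
    (1 - rho) / 2 <= expR (- (eta * y)) <= (1 + rho) / 2 &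
    H1 y - H2 y < C * eta `^ (1 - s)].
Proof.
move=> i1 i2 H10 H20 c1 c2 C0 /andP[rho0 rho1].
have ih : laplace_integrable (fun y => H1 y - H2 y).
  move=> eta eta0.
  have -> : (fun y : R => (expR (- (eta * y)) * (H1 y - H2 y))%:E) =
      ((fun y => (expR (- (eta * y)) * H1 y)%:E) \- (fun y => (expR (- (eta * y)) * H2 y)%:E))%E.
    by apply/funext => y; rewrite /= mulrBr EFinB.
  by apply: integrableB => //; [exact: i1|exact: i2].
have ch : eta `^ s * \int[lebesgue_measure]_(y in `]0, +oo[)
    (expR (- (eta * y)) * (H1 y - H2 y)) @[eta --> 0^'+] --> (0 : R).
  have : eta `^ s * \int[lebesgue_measure]_(y in `]0, +oo[) (expR (- (eta * y)) * H1 y) -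
    eta `^ s * \int[lebesgue_measure]_(y in `]0, +oo[) (expR (- (eta * y)) * H2 y)
    @[eta --> 0^'+] --> (0 : R).
    by rewrite -[X in _ --> X](subrr K); apply: cvgB.
  apply: cvg_trans; apply: near_eq_cvg; near=> eta.
  have eta0 : 0 < eta by near: eta; exact: nbhs_right_gt.
  rewrite -mulrBr -RintegralB//; [|exact: i1|exact: i2].
  by congr (_ * _); apply: eq_Rintegral => y _; rewrite mulrBr.
(* [th] bounds 4u(1-u) from above off the window, [th'] from below on an inner interval of length l
   / eta. *)
pose th : R := 1 - rho ^+ 2.
pose th' : R := 1 - (rho / 2) ^+ 2.
have th0 : 0 < th by rewrite subr_gt0 expr_lt1// ltW.
have thth' : th < th' by rewrite /th /th'; nra.
have th'0 : 0 < th' by exact: lt_trans thth'.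
pose l : R := - ln (1 - rho / 2).
have l0 : 0 < l by rewrite oppr_gt0 ln_lt0//; apply/andP; split; lra.
have K10 : 0 < `|K| + 1 by rewrite ltr_wpDl.
(* Since th < th', a large exponent makes the contribution from outside the window less than half of
   that of the inner interval. *)
have [N' HN'] : exists N' : nat, 4 * (`|K| + 1) * th ^+ N' < C * l / 2 * th' ^+ N'.+1.
  have : (th / th') ^+ n @[n --> \oo] --> (0 : R).
    by apply: cvg_expr; rewrite ger0_norm ?divr_ge0 ?ltW// ltr_pdivrMr// mul1r.
  have e0 : 0 < C * l / 2 * th' / (4 * (`|K| + 1)).
    by rewrite !(divr_gt0, mulr_gt0).
  move=> /cvgr0_norm_lt /(_ _ e0) [N' _ /(_ N' (leqnn _))] /=.
  rewrite ger0_norm ?exprn_ge0 ?divr_ge0 ?ltW// expr_div_n ltr_pdivlMr ?mulr_gt0//.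
  rewrite mulrC mulrA ltr_pdivrMr ?exprn_gt0// => h; exists N'.
  by rewrite exprS mulrA.
pose N := N'.+1.
have e0 : 0 < C * l / 2 * th' ^+ N / 4 ^+ N by rewrite !mulr_gt0 ?invr_gt0 ?exprn_gt0.
have /cvgr0_norm_lt /(_ _ e0) near1 := laplace_kernel_cvg0 N N' ih ch.
have KK1 : K < `|K| + 1 by rewrite (le_lt_trans (ler_norm K))// ltrDl.
have near2 := c2; move: near2 => /cvgr_lt /(_ _ KK1) near2.
near=> eta.
have eta0 : 0 < eta by near: eta; exact: nbhs_right_gt.
have W1 : `| eta `^ s * \int[lebesgue_measure]_(y in `]0, +oo[)
     (expR (- (eta * y)) ^+ N * (1 - expR (- (eta * y))) ^+ N * (H1 y - H2 y)) |
     < C * l / 2 * th' ^+ N / 4 ^+ N.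
  by near: eta.
have W2 : eta `^ s * \int[lebesgue_measure]_(y in `]0, +oo[)
    (expR (- (eta * y)) * H2 y) < `|K| + 1.
  by near: eta.
(* Suppose H1 - H2 >= C eta^(1-s) on the whole window. Integrating the pointwise bound [pw] and
   multiplying by eta^s leaves more than C l th'^N / 2 on the left, whereas [W1] keeps the right
   side below that value. *)
apply: contrapT => /forallNP nex.
have inside y : 0 < y -> (1 - rho) / 2 <= expR (- (eta * y)) <= (1 + rho) / 2 ->
    C * eta `^ (1 - s) <= H1 y - H2 y.
  by move=> y0 uy; rewrite leNgt; apply/negP => h; exact: (nex y).
(* On [I] the variable u decreases from 1/2 to (1 - rho/2)/2. *)
pose I : set R := `[ln 2 / eta, (ln 2 + l) / eta]%classic.
have ln20 : 0 < ln (2 : R) by rewrite ln_gt0// ltr1n.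
have ID : I `<=` `]0%R, +oo[%classic.
   move=> y; rewrite /I /= !in_itv/= andbT => /andP[yl _].
  by apply: lt_le_trans yl; rewrite divr_gt0.
have Iu y : I y -> (1 - rho / 2) / 2 <= expR (- (eta * y)) <= 1 / 2.
  rewrite /I/= in_itv/= ler_pdivrMr// ler_pdivlMr// !(mulrC y) => /andP[y1 y2].
  apply/andP; split.
    rewrite -[leLHS]lnK ?posrE; last by rewrite divr_gt0//; lra.
    rewrite ler_expR ln_div ?posrE//; last by lra.
    by move: y2; rewrite /l; lra.
  rewrite -[leRHS]lnK ?posrE// ler_expR ln_div ?posrE// ln1; lra.
pose c1' := C * eta `^ (1 - s) * th' ^+ N.
pose c2' := 4 * th ^+ N'.
have pw y : 0 < y -> c1' * \1_I y - c2' * (expR (- (eta * y)) * H2 y) <=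
    4 ^+ N * (expR (- (eta * y)) ^+ N * (1 - expR (- (eta * y))) ^+ N * (H1 y - H2 y)).
  move=> y0; have u1 : 0 <= expR (- (eta * y)) <= 1.
    by rewrite expR_ge0 -expR0 ler_expR oppr_le0 mulr_ge0// ltW.
  have Ce0 : 0 <= C * eta `^ (1 - s) by rewrite mulr_ge0 ?powR_ge0 ?ltW.
  have rho01 : 0 < rho < 1 by rewrite rho0.
  rewrite [leRHS]mulrA [X in _ <= X * _]mulrA -!exprMn indicE.
  apply: (window_kernel_ge _ rho01 Ce0 u1 (H10 _ y0) (H20 _ y0)).
    by rewrite inE; exact: Iu.
  exact: inside.
have iu2 := i2 eta eta0.
have mI : measurable I by exact: measurable_itv.
have muI : (lebesgue_measure I = (l / eta)%:E)%E.
  rewrite /I lebesgue_measure_itv/= lte_fin ltr_pM2r ?invr_gt0// ltrDl l0.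
  by rewrite -EFinD/= -mulrBl addrAC subrr add0r.
have iI : lebesgue_measure.-integrable `]0%R, +oo[ (fun y : R => (\1_I y)%:E).
  apply: integrableS (integrable_indic_itv _ _ _ _) => //.
have iK := laplace_integrable_kernel N' N ih eta0.
have i1' := @integrableZl _ _ _ lebesgue_measure _ (measurable_itv `]0%R, +oo[) c1' _ iI.
have i2' := @integrableZl _ _ _ lebesgue_measure _ (measurable_itv `]0%R, +oo[) c2' _ iu2.
have iK' := @integrableZl _ _ _ lebesgue_measure _ (measurable_itv `]0%R, +oo[) (4 ^+ N) _ iK.
have i12 := @integrableB _ _ _ lebesgue_measure _ (measurable_itv `]0%R, +oo[) _ _ i1' i2'.
have := @le_Rintegral _ _ _ lebesgue_measure `]0%R, +oo[
  (fun y => c1' * \1_I y - c2' * (expR (- (eta * y)) * H2 y))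
  (fun y => 4 ^+ N * (expR (- (eta * y)) ^+ N * (1 - expR (- (eta * y))) ^+ N * (H1 y - H2 y)))
  (measurable_itv _) i12 iK'.
rewrite RintegralB// 3?RintegralZl//.
have -> : \int[lebesgue_measure]_(y in `]0, +oo[) \1_I y = l / eta.
  by rewrite /Rintegral integral_indic// setIidl//; exact: (congr1 fine muI).
move=> Hle; have {}Hle : c1' * (l / eta) - c2' * \int[lebesgue_measure]_(y in `]0, +oo[) (expR (- (eta * y)) * H2 y)
    <= 4 ^+ N * \int[lebesgue_measure]_(y in `]0, +oo[)
     (expR (- (eta * y)) ^+ N * (1 - expR (- (eta * y))) ^+ N * (H1 y - H2 y)).
  by apply: Hle => y /=; rewrite in_itv/= andbT; exact: pw.
have es0 : 0 < eta `^ s by exact: powR_gt0.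
have {Hle} := ler_wpM2l (ltW es0) Hle.
rewrite mulrBr /c1' (_ : eta `^ s * _ = C * l * th' ^+ N); last first.
  have : eta `^ s * eta `^ (1 - s) = eta.
    by rewrite -powRD ?(gt_eqF eta0) ?implybT// addrC subrK powRr1// ltW.
  move: (_ `^ s) (_ `^ (1 - s)) => a b ab.
  rewrite (_ : _ * _ = (a * b) * (C * th' ^+ N * l / eta)); last by ring.
  by rewrite ab mulrCA divff ?mulr1 ?gt_eqF//; ring.
rewrite (mulrCA (eta `^ s) c2') (mulrCA (eta `^ s) (4 ^+ N)).
move: W1 W2 => /ltr_normlW; rewrite ltr_pdivlMr ?exprn_gt0// mulrC.
set X := eta `^ s * _; set Z := eta `^ s * _ => W1 W2.
have W3 : c2' * Z <= c2' * (`|K| + 1) by rewrite ler_wpM2l ?(ltW W2)// mulr_ge0// exprn_ge0// ltW.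
move: W1 W3 HN'; rewrite /c2' -/N => W1 W3 HN'.
nra.
Unshelve. all: by end_near. Qed.

Lemma near_pinfty_div (R : realType) (c : R) (Q : R -> Prop) : 0 < c ->
  (\forall eta \near 0^'+, Q eta) -> \forall x \near +oo, Q (c / x).
Proof.
move=> c0 [e /= e0 Qe]; near=> x.
have x0 : 0 < x by [].
apply: Qe; last by rewrite divr_gt0.
rewrite /= sub0r normrN ger0_norm ?divr_ge0 ?ltW// ltr_pdivrMr// mulrC -ltr_pdivrMr//.
by near: x; apply: nbhs_pinfty_gt; rewrite num_real.
Unshelve. all: by end_near. Qed.

Lemma laplace_integrable_powR (R : realType) (b c : R) : 0 < b < 1 ->
  laplace_integrable (fun y => c * y `^ (- b)).
Proof.
move=> /andP[b0 b1] eta eta0.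
have b01 : 0 < 1 - b <= 1 by rewrite subr_gt0 b1/= gerBl ltW.
have E := laplace_powR b01 eta0.
have -> : (fun y : R => (expR (- (eta * y)) * (c * y `^ (- b)))%:E) =
   (fun y => c%:E * (expR (- (eta * y)) * y `^ (1 - b - 1))%:E)%E.
  by apply/funext => y; rewrite -EFinM (_ : 1 - b - 1 = - b); [congr EFin; ring|ring].
apply: integrableZl => //; apply/integrableP; split.
  apply/measurable_EFinP; apply: measurable_funM; first exact: measurable_expRN_scale.
  by apply: measurable_funTS; exact: measurable_powR.
under eq_integral do rewrite gee0_abs ?lee_fin ?mulr_ge0 ?expR_ge0 ?powR_ge0//.
by rewrite E ltry.
Qed.

(** By monotonicity a single point of the window controls G x, provided eta places the whole window
    on one side of x. As rho -> 0 the window shrinks to eta y = ln 2, and the loss in comparing y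
    with x disappears. *)
Lemma karamata_monotone (R : realType) (G : R -> R) (b K : R) : 0 < b < 1 -> 0 < K ->
  laplace_integrable G ->
  (forall y, 0 < y -> 0 <= G y) -> (forall x y, 0 < x -> x <= y -> G y <= G x) ->
  eta `^ (1 - b) * \int[lebesgue_measure]_(y in `]0, +oo[) (expR (- (eta * y)) * G y)
    @[eta --> 0^'+] --> K ->
  G x * x `^ b @[x --> +oo] --> K / Gamma (1 - b).
Proof.
move=> b01 K0 iG G0 Gm cG; have /andP[b0 b1] := b01.
have a01 : 0 < 1 - b <= 1 by rewrite subr_gt0 b1/= gerBl ltW.
have Ga0 := Gamma_gt0 a01.
pose K' := K / Gamma (1 - b).
have K'0 : 0 < K' by rewrite divr_gt0.
pose H y := K' * y `^ (- b).
have H0 y : 0 < y -> 0 <= H y by move=> y0; rewrite mulr_ge0 ?powR_ge0 ?ltW.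
have iH : laplace_integrable H by exact: laplace_integrable_powR.
have cH : eta `^ (1 - b) * \int[lebesgue_measure]_(y in `]0, +oo[) (expR (- (eta * y)) * H y)
    @[eta --> 0^'+] --> K.
  have cK : (fun _ : R => K) @ 0^'+ --> K by exact: cvg_cst.
  apply: cvg_trans cK; apply: near_eq_cvg; near=> eta.
  have eta0 : 0 < eta by near: eta; exact: nbhs_right_gt.
  have E := laplace_powR a01 eta0.
  have -> : \int[lebesgue_measure]_(y in `]0, +oo[) (expR (- (eta * y)) * H y) =
      \int[lebesgue_measure]_(y in `]0, +oo[) (K' * (expR (- (eta * y)) * y `^ (1 - b - 1))).
    apply: eq_Rintegral => y _; rewrite /H (_ : 1 - b - 1 = - b); last by ring.
    by rewrite mulrCA.
  rewrite RintegralZl//; last first.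
    apply: eq_integrable (laplace_integrable_powR 1 b01 eta0) => // y _ /=.
    by rewrite mul1r (_ : 1 - b - 1 = - b)//; ring.
  rewrite /Rintegral E/= mulrCA (mulrA (eta `^ _)) -powRD; last by rewrite (gt_eqF eta0) implybT.
  by rewrite subrr powRr0 mul1r /K' divfK ?gt_eqF.
(* Endpoints of the window for the product eta y. *)
pose A rho : R := - ln ((1 + rho) / 2).
pose B rho : R := - ln ((1 - rho) / 2).
have ln2 : 0 < ln (2 : R) by rewrite ln_gt0// ltr1n.
have cA : A rho @[rho --> 0^'+] --> ln 2.
  rewrite (_ : ln 2 = - ln ((1 + 0) / 2)); last by rewrite addr0 div1r lnV ?opprK// posrE.
  apply: cvgN; apply: continuous_cvg; first by apply: continuous_ln; rewrite addr0 divr_gt0.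
  apply: cvgMr_tmp; apply: cvgD; first exact: cvg_cst.
  exact: cvg_at_right_filter.
have cB : B rho @[rho --> 0^'+] --> ln 2.
  rewrite (_ : ln 2 = - ln ((1 - 0) / 2)); last by rewrite subr0 div1r lnV ?opprK// posrE.
  apply: cvgN; apply: continuous_cvg; first by apply: continuous_ln; rewrite subr0 divr_gt0.
  apply: cvgMr_tmp; apply: cvgB; first exact: cvg_cst.
  exact: cvg_at_right_filter.
have cU : K' * (B rho / A rho) `^ b @[rho --> 0^'+] --> K'.
  rewrite -[X in _ --> X]mulr1; apply: cvgMl_tmp.
  rewrite [X in _ --> X](_ : 1 = (ln 2 / ln 2) `^ b); last by rewrite divff ?gt_eqF// powR1.
  apply: (@continuous_cvg _ _ _ _ _ (fun rho => B rho / A rho) (fun y => y `^ b));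
    first by apply: powR_continuous_gt0; rewrite divr_gt0.
  by apply: cvgM => //; apply: cvgV => //; rewrite gt_eqF.
have cL : K' * (A rho / B rho) `^ b @[rho --> 0^'+] --> K'.
  rewrite -[X in _ --> X]mulr1; apply: cvgMl_tmp.
  rewrite [X in _ --> X](_ : 1 = (ln 2 / ln 2) `^ b); last by rewrite divff ?gt_eqF// powR1.
  apply: (@continuous_cvg _ _ _ _ _ (fun rho => A rho / B rho) (fun y => y `^ b));
    first by apply: powR_continuous_gt0; rewrite divr_gt0.
  by apply: cvgM => //; apply: cvgV => //; rewrite gt_eqF.
apply/cvgrPdist_le => e e0.
have e20 : 0 < e / 2 by rewrite divr_gt0.
have /cvgrPdist_lt /(_ _ e20) cU' := cU.
have /cvgrPdist_lt /(_ _ e20) cL' := cL.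
near (0 : R)^'+ => rho.
have rho0 : 0 < rho by near: rho; exact: nbhs_right_gt.
have rho1 : rho < 1 by near: rho; exact: nbhs_right_lt.
have : `|K' - K' * (B rho / A rho) `^ b| < e / 2 by near: rho.
have : `|K' - K' * (A rho / B rho) `^ b| < e / 2 by near: rho.
rewrite !ltr_distlC => /andP[L1 _] /andP[_ U1].
have A0 : 0 < A rho by rewrite oppr_gt0 ln_lt0//; apply/andP; split; lra.
have B0 : 0 < B rho by rewrite oppr_gt0 ln_lt0//; apply/andP; split; lra.
have rho01 : 0 < rho < 1 by rewrite rho0.
have win eta y : (1 - rho) / 2 <= expR (- (eta * y)) <= (1 + rho) / 2 ->
    A rho <= eta * y <= B rho.
  move=> /andP[u1 u2]; apply/andP; split.
    by rewrite lerNl -ler_expR lnK ?posrE//; lra.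
  by rewrite lerNr -ler_expR lnK ?posrE//; lra.
(* With these constants the window error multiplied by x^b is exactly e/2, at eta = B rho / x and at
   eta = A rho / x respectively. *)
have CB0 : 0 < e / 2 / B rho `^ b by rewrite divr_gt0 ?powR_gt0.
have CA0 : 0 < e / 2 / A rho `^ b by rewrite divr_gt0 ?powR_gt0.
have := tauberian_window iG iH G0 H0 cG cH CB0 rho01.
move=> /(near_pinfty_div B0) nU.
have := tauberian_window iH iG H0 G0 cH cG CA0 rho01.
move=> /(near_pinfty_div A0) nL.
rewrite (_ : 1 - (1 - b) = b) in nU nL; last by ring.
near=> x.
have x0 : 0 < x by [].
have xb0 : 0 < x `^ b by exact: powR_gt0.
rewrite -/K' ler_distlC; apply/andP; split.
  (* Lower bound: for eta = A rho / x the window consists of points x <= y <= (B rho / A rho) x, so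
     G x >= G y. *)
  have [y [y0 /win yw Hy]] : exists y, [/\ 0 < y,
    (1 - rho) / 2 <= expR (- (A rho / x * y)) <= (1 + rho) / 2 &
    H y - G y < e / 2 / A rho `^ b * (A rho / x) `^ b] by near: x.
  have /andP[y1 y2] := yw.
  have xy : x <= y by move: y1; rewrite mulrAC ler_pdivlMr// ler_pM2l.
  have Gxy := Gm x y x0 xy.
  have Hl : K' * (A rho / B rho) `^ b <= H y * x `^ b.
    rewrite /H -mulrA ler_pM2l// powRN [leRHS]mulrC ler_pdivlMr ?powR_gt0//.
    rewrite -powRM ?divr_ge0 ?(ltW A0) ?(ltW B0) ?(ltW x0) ?(ltW y0)//;
    apply: (ge0_ler_powR (ltW b0));
    rewrite ?nnegrE ?mulr_ge0 ?divr_ge0 ?invr_ge0 ?(ltW A0) ?(ltW B0) ?(ltW x0) ?(ltW y0)//.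
    by move: y2; rewrite mulrAC ler_pdivrMr// mulrAC ler_pdivrMr// (mulrC x).
  have := ler_wpM2r (ltW xb0) Gxy.
  have : (H y - G y) * x `^ b <= e / 2.
    rewrite (le_trans (ler_wpM2r (ltW xb0) (ltW Hy)))//.
    rewrite -[leLHS]mulrA -powRM ?divr_ge0 ?(ltW A0) ?(ltW B0) ?(ltW x0) ?(ltW y0)// divfK ?gt_eqF//.
    by rewrite divfK ?gt_eqF ?powR_gt0.
  rewrite mulrBl; lra.
(* Upper bound: for eta = B rho / x the window consists of points (A rho / B rho) x <= y <= x, so G
   x <= G y. *)
have [y [y0 /win yw Hy]] : exists y, [/\ 0 < y,
    (1 - rho) / 2 <= expR (- (B rho / x * y)) <= (1 + rho) / 2 &
    G y - H y < e / 2 / B rho `^ b * (B rho / x) `^ b] by near: x.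
have /andP[y1 y2] := yw.
have xy : y <= x by move: y2; rewrite mulrAC ler_pdivrMr// ler_pM2l.
have Gxy := Gm y x y0 xy.
have Hl : H y * x `^ b <= K' * (B rho / A rho) `^ b.
  rewrite /H -mulrA ler_pM2l// powRN [leLHS]mulrC ler_pdivrMr ?powR_gt0//.
  rewrite -powRM ?divr_ge0 ?(ltW A0) ?(ltW B0) ?(ltW x0) ?(ltW y0)//;
    apply: (ge0_ler_powR (ltW b0));
    rewrite ?nnegrE ?mulr_ge0 ?divr_ge0 ?invr_ge0 ?(ltW A0) ?(ltW B0) ?(ltW x0) ?(ltW y0)//.
  by move: y1; rewrite mulrAC ler_pdivlMr// mulrAC ler_pdivlMr// (mulrC x).
have := ler_wpM2r (ltW xb0) Gxy.
have : (G y - H y) * x `^ b <= e / 2.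
  rewrite (le_trans (ler_wpM2r (ltW xb0) (ltW Hy)))//.
  rewrite -[leLHS]mulrA -powRM ?divr_ge0 ?(ltW A0) ?(ltW B0) ?(ltW x0) ?(ltW y0)// divfK ?gt_eqF//.
  by rewrite divfK ?gt_eqF ?powR_gt0.
rewrite mulrBl; lra.
Unshelve. all: by end_near. Qed.

(** * Discretization of the random time *)

(** Independence says that the image under [X] of P restricted to [A] is P(A) times the law of
    [X]. *)
Lemma ge0_integral_indep d (T : measurableType d) (R : realType) (P : probability T R)
    (X : {RV P >-> R}) (A : set T) (f : R -> \bar R) :
  measurable A -> measurable_fun setT f -> (forall x, (0 <= f x)%E) ->
  (forall B, measurable B -> P (A `&` X @^-1` B) = (P A * P (X @^-1` B))%E) ->
  (\int[P]_(w in A) f (X w) = P A * \int[P]_w f (X w))%E.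
Proof.
move=> mA mf f0 AX.
have mfX : measurable_fun setT (f \o X) by exact: measurableT_comp.
have PA : P A \is a fin_num by exact: fin_num_measure.
have PA0 : 0 <= fine (P A) by exact: fine_ge0.
transitivity (\int[mrestr P mA]_(w in A) f (X w))%E.
  by apply: eq_measure_integral => B mB BA; rewrite /= /mrestr setIidl.
transitivity (\int[mrestr P mA]_w f (X w))%E.
  rewrite [RHS](@ge0_negligible_integral _ _ _ _ setT (~` A))//.
  - by rewrite setTD setCK.
  - exact: measurableC.
  - by rewrite /= /mrestr setICl measure0.
transitivity (\int[pushforward (mrestr P mA) X]_x f x)%E.
  by rewrite ge0_integral_pushforward.
transitivity (\int[mscale (NngNum PA0) (distribution P X)]_x f x)%E.
  apply: eq_measure_integral => B mB _.
  transitivity (P (A `&` X @^-1` B)); first by rewrite setIC.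
  by rewrite AX// -{1}(fineK PA).
by rewrite ge0_integral_mscale//= fineK// ge0_integral_distribution.
Qed.

(* [grid n x] is strictly greater than [x], so that right-continuity applies. *)
Definition grid (R : realType) (n : nat) (x : R) : R :=
  (Num.truncn (n.+1%:R * x)).+1%:R / n.+1%:R.

(** The cells are closed on the left so that [grid n] is constant on each, equal to its right
    endpoint. *)
Definition grid_cell (R : realType) (n k : nat) : set R :=
  [set` `[k%:R / n.+1%:R, k.+1%:R / n.+1%:R[ ].

Lemma grid_cellP (R : realType) (n k : nat) (x : R) : 0 <= x ->
  grid_cell n k x <-> Num.truncn (n.+1%:R * x) = k.
Proof.
move=> x0; have nx0 : 0 <= n.+1%:R * x by rewrite mulr_ge0.
rewrite /grid_cell /= in_itv/= ler_pdivrMr// ltr_pdivlMr// (mulrC x) -truncn_eq//.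
by split => [/eqP|->].
Qed.

Lemma grid_cell_ge0 (R : realType) (n k : nat) (x : R) : grid_cell n k x -> 0 <= x.
Proof.
by rewrite /grid_cell /= in_itv/= => /andP[+ _]; apply: le_trans; rewrite divr_ge0.
Qed.

Lemma grid_cellE (R : realType) (n k : nat) (x : R) :
  grid_cell n k x -> grid n x = k.+1%:R / n.+1%:R.
Proof. by move=> nkx; rewrite /grid ((grid_cellP n k (grid_cell_ge0 nkx)).1 nkx). Qed.

Lemma measurable_grid_cell (R : realType) (n k : nat) : measurable (grid_cell n k : set R).
Proof. exact: measurable_itv. Qed.

Lemma bigcup_grid_cell (R : realType) (n : nat) :
  \bigcup_k grid_cell n k = [set x : R | 0 <= x].
Proof.
apply/seteqP; split => x /=; first by move=> [k _]; exact: grid_cell_ge0.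
by move=> x0; exists (Num.truncn (n.+1%:R * x)) => //; exact/grid_cellP.
Qed.

Lemma trivIset_grid_cell (R : realType) (n : nat) : trivIset setT (@grid_cell R n).
Proof.
apply/trivIsetP => i j _ _ ij; rewrite -subset0 => x [xi xj].
have x0 := grid_cell_ge0 xi.
move/eqP: ij; apply.
by rewrite -((grid_cellP n i x0).1 xi) -((grid_cellP n j x0).1 xj).
Qed.

Lemma grid_gt (R : realType) (n : nat) (x : R) : x < grid n x.
Proof. by rewrite /grid ltr_pdivlMr// mulrC truncnS_gt. Qed.

Lemma cvg_grid (R : realType) (x : R) : 0 <= x -> grid n x @[n --> \oo] --> x.
Proof.
move=> x0; apply: (@squeeze_cvgr _ _ _ _ (fun=> x) (fun n => x + harmonic n)).
- apply: nearW => n; rewrite (ltW (grid_gt n x))/= /grid /harmonic.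
  rewrite -natr1 mulrDl mul1r lerD2r ler_pdivrMr// [leRHS]mulrC.
  by have /andP[] := truncn_itv (mulr_ge0 (ler0n R n.+1) x0).
- exact: cvg_cst.
- rewrite -[X in _ --> X]addr0; apply: cvgD; [exact: cvg_cst|exact: cvg_harmonic].
Qed.

Lemma cvg_right_grid (R : realType) (x : R) (f : R -> R) (l : R) : 0 <= x ->
  f y @[y --> x^'+] --> l -> f (grid n x) @[n --> \oo] --> l.
Proof.
move=> x0 /cvg_at_rightP; apply; split => [n|]; first exact: grid_gt.
exact: cvg_grid.
Qed.

Section discretization.
Context d (T : measurableType d) (R : realType) (P : probability T R).
Variables (X : R -> {RV P >-> R}) (V : {RV P >-> R}).
Hypothesis XV : forall s B C, 0 <= s -> measurable B -> measurable C ->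
  P (V @^-1` C `&` X s @^-1` B) = (P (V @^-1` C) * P (X s @^-1` B))%E.

Let D := V @^-1` [set x | 0 <= x].
Let cell n k := V @^-1` grid_cell n k.

Let mcell n k : measurable (cell n k).
Proof. by apply: measurable_funPTI; exact: measurable_grid_cell. Qed.

Let DE n : D = \bigcup_k cell n k.
Proof. by rewrite /D -(bigcup_grid_cell R n) preimage_bigcup. Qed.

Lemma measurable_preimage_ge0 : measurable D.
Proof. by rewrite (DE 0); exact: bigcup_measurable. Qed.

Let tcell n : trivIset setT (cell n).
Proof.
by apply/trivIsetP => i j _ _ ij; rewrite /cell -preimage_setI
  (trivIsetP.1 (@trivIset_grid_cell R n)) ?preimage_set0.
Qed.

(** On each cell the map is one random variable, [X] at the right endpoint, so countable gluing
    takes the place of joint measurability of [X]. *)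
Lemma measurable_grid_comp n : measurable_fun D (fun w => X (grid n (V w)) w).
Proof.
rewrite (DE n); apply/measurable_fun_bigcup => // k.
apply: (eq_measurable_fun (X (k.+1%:R / n.+1%:R))) => [w|].
  by rewrite inE => /grid_cellE ->.
exact: measurable_funP.
Qed.

Lemma measurable_grid n : measurable_fun D (fun w => grid n (V w)).
Proof.
rewrite (DE n); apply/measurable_fun_bigcup => // k.
apply: (eq_measurable_fun (fun=> k.+1%:R / n.+1%:R : R)) => [w|].
  by rewrite inE => /grid_cellE ->.
exact: measurable_cst.
Qed.

(** Conditioning on the grid-valued time by hand: on a cell the time is a constant s, independence
    gives P(cell) g(s), and summing over the countably many cells recovers the integral of [g]. *)
Lemma integral_grid_comp n (f : R -> \bar R) (g : R -> \bar R) :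
  measurable_fun setT f -> (forall x, (0 <= f x)%E) ->
  measurable_fun setT g -> (forall x, (0 <= g x)%E) ->
  (forall s : R, (0 <= s)%R -> \int[P]_w f (X s w) = g s)%E ->
  (\int[P]_(w in D) f (X (grid n (V w)) w) = \int[P]_(w in D) g (grid n (V w)))%E.
Proof.
move=> mf f0 mg g0 fg; rewrite (DE n) !ge0_integral_bigcup//; last 2 first.
- by rewrite -(DE n); apply: (measurableT_comp mg); exact: measurable_grid.
- by rewrite -(DE n); apply: (measurableT_comp mf); exact: measurable_grid_comp.
apply: eq_eseriesr => k _.
transitivity (\int[P]_(w in cell n k) f (X (k.+1%:R / n.+1%:R) w))%E.
  by apply: eq_integral => w; rewrite inE => /grid_cellE ->.
have s0 : 0 <= k.+1%:R / n.+1%:R :> R by rewrite divr_ge0.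
rewrite ge0_integral_indep// => [|B mB]; last first.
  by apply: XV => //; exact: measurable_grid_cell.
rewrite fg// muleC -integral_cst//.
by apply: eq_integral => w; rewrite inE => /grid_cellE ->.
Qed.

End discretization.

(** * Laplace transform of the positive part *)

Lemma le_expR_scale (R : realType) (r x : R) : 0 <= r <= 1 ->
  expR (r * x) <= 1 + r * (expR x - 1).
Proof.
move=> /andP[r0 r1].
have e1 : expR (r * x) * (1 + (x - r * x)) <= expR x.
  rewrite -[X in _ <= expR X](subrK (r * x) x) expRD [leRHS]mulrC.
  by rewrite ler_wpM2l ?expR_ge0// expR_ge1Dx.
have e2 : expR (r * x) * (1 - r * x) <= 1.
  rewrite -[leRHS]expR0 -[X in _ <= expR X](subrr (r * x)) expRD.
  by rewrite ler_wpM2l ?expR_ge0// expR_ge1Dx.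
(* [r] times [e1] plus 1 - r times [e2]: the linear terms cancel, which gives convexity between 0
   and x. *)
nra.
Qed.

Lemma probability_integral_le1 d (T : measurableType d) (R : realType) (P : probability T R)
  (D : set T) (f : T -> R) : measurable D -> measurable_fun D f ->
  (forall w, D w -> 0 <= f w <= 1) -> (\int[P]_(w in D) (f w)%:E <= 1)%E.
Proof.
move=> mD mf f01; apply: (@le_trans _ _ (\int[P]_(w in D) (cst 1 w))%E).
  apply: ge0_le_integral => //.
  - by move=> w /f01 /andP[]; rewrite lee_fin.
  - exact/measurable_EFinP.
  - by move=> w /f01 /andP[]; rewrite lee_fin.
by rewrite integral_cst// mul1e probability_le1.
Qed.

Section laplace_bounds.
Context d (T : measurableType d) (R : realType) (P : probability T R).
Variables (X : R -> {RV P >-> R}) (V Z : {RV P >-> R}) (psi : R -> R).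
Hypothesis XV : forall s B C, 0 <= s -> measurable B -> measurable C ->
  P (V @^-1` C `&` X s @^-1` B) = (P (V @^-1` C) * P (X s @^-1` B))%E.
Hypothesis Xpsi : forall s eta, 0 <= s -> 0 < eta ->
  (\int[P]_w (expR (- (eta * X s w)))%:E = (expR (- (s * psi eta)))%:E)%E.
Hypothesis V0 : {ae P, forall w, 0 <= V w}.
Hypothesis XZ : {ae P, forall w, X (grid n (V w)) w @[n --> \oo] --> Z w}.

Let D := V @^-1` [set x | 0 <= x].
Let mD : measurable D := measurable_preimage_ge0 V.

Let integral_D (f : T -> \bar R) : measurable_fun setT f -> (forall w, (0 <= f w)%E) ->
  (\int[P]_w f w = \int[P]_(w in D) f w)%E.
Proof.
move=> mf f0; have mCD : measurable (~` D) by exact: measurableC.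
rewrite (@ge0_negligible_integral _ _ _ _ setT (~` D))//; first by rewrite setTD setCK.
exact: measure_negligible.
Qed.

Let mexp (a : R) : measurable_fun [set: R] (fun x : R => (expR (- (a * x)))%:E).
Proof.
apply/measurable_EFinP; apply: measurableT_comp => //; apply: measurableT_comp => //.
Qed.

Let mexpmax (a : R) : measurable_fun [set: R] (fun x : R => (expR (- (a * Num.max x 0)))%:E).
Proof. by apply: (measurableT_comp (mexp a)); exact: measurable_maxr. Qed.

Let grid_laplace n eta : 0 < eta ->
  (\int[P]_(w in D) (expR (- (eta * X (grid n (V w)) w)))%:E =
   \int[P]_(w in D) (expR (- (psi eta * grid n (V w))))%:E)%E.
Proof.
move=> eta0.
apply: (@integral_grid_comp _ _ _ _ _ _ XV n (fun x => (expR (- (eta * x)))%:E)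
  (fun x => (expR (- (psi eta * x)))%:E)) => //.
by move=> s s0; rewrite Xpsi// mulrC.
Qed.

Let cvg_dominated (f : R -> R) (u : nat -> T -> R) (v : T -> R) :
  measurable_fun setT f -> continuous f -> (forall x, 0 <= f x) ->
  (forall n, measurable_fun D (u n)) -> measurable_fun D v ->
  (forall n w, D w -> f (u n w) <= 1) ->
  {ae P, forall w, D w -> u n w @[n --> \oo] --> v w} ->
  (\int[P]_(w in D) (f (u n w))%:E @[n --> \oo] --> \int[P]_(w in D) (f (v w))%:E)%E.
Proof.
move=> mf cf f0 mu mv f1 uv.
have [] := @dominated_convergence _ _ _ P D mD (fun n w => (f (u n w))%:E)
  (fun w => (f (v w))%:E) (cst 1%E).
- by move=> n; apply/measurable_EFinP; apply: (measurableT_comp mf).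
- by apply/measurable_EFinP; apply: (measurableT_comp mf).
- apply: filterS uv => w uvw Dw; apply: cvg_EFin; first by apply: nearW.
  by apply: continuous_cvg; [exact: cf|exact: uvw].
- exact: finite_measure_integrable_cst.
- by apply: aeW => w n Dw; rewrite gee0_abs lee_fin ?f1.
- by [].
Qed.

(* The limit along the grid is taken for the bounded integrand
   [exp (- eta max (x, 0))] only: for [x < 0] it differs from [exp (- eta x)] by at
   most [(eta / eta0) exp (- eta0 x)], by convexity. *)
Lemma laplace_positive_part_bounds eta eta0 : 0 < eta <= eta0 ->
  0 <= psi eta -> 0 <= psi eta0 ->
  (\int[P]_w (expR (- (psi eta * V w)))%:E - (eta / eta0)%:E <=
     \int[P]_w (expR (- (eta * Num.max (Z w) 0)))%:E <=
   \int[P]_w (expR (- (psi eta * V w)))%:E)%E.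
Proof.
move=> /andP[eta_gt0 le_eta] psi0 psi00.
have eta0_gt0 : 0 < eta0 by exact: lt_le_trans le_eta.
pose r := eta / eta0.
have r01 : 0 <= r <= 1 by rewrite /r divr_ge0 ?(ltW eta_gt0) ?(ltW eta0_gt0)//= ler_pdivrMr// mul1r.
have /andP[r0 _] := r01.
have r_gt0 : 0 < r by rewrite divr_gt0.
have mVT : measurable_fun setT V by exact: measurable_funP.
have mZT : measurable_fun setT Z by exact: measurable_funP.
have mX n := @measurable_grid_comp _ _ _ _ X V n.
have mG n := @measurable_grid _ _ _ _ V n.
have max_le x : expR (- (eta * Num.max x 0)) <= expR (- (eta * x)).
  by rewrite ler_expR lerN2 ler_pM2l// le_max lexx.
have le_maxD x : expR (- (eta * x)) <=
    expR (- (eta * Num.max x 0)) + r * expR (- (eta0 * x)).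
  have [x0|x0] := leP 0 x.
    by rewrite lerDl mulr_ge0 ?expR_ge0.
  rewrite mulr0 oppr0 expR0 (_ : - (eta * x) = r * (- (eta0 * x))); last first.
    by rewrite mulrN mulrA divfK ?gt_eqF.
  by apply: le_trans (le_expR_scale _ r01) _; rewrite lerD2l ler_wpM2l// gerBl.
rewrite !integral_D//; last 2 first.
- exact: (measurableT_comp (mexpmax _)).
- exact: (measurableT_comp (mexp _)).
(* [a n] is the positive-part transform at the grid time; [b n] is the transform of the grid time
   itself, which [grid_laplace] identifies with the untruncated transform. *)
pose a n := (\int[P]_(w in D) (expR (- (eta * Num.max (X (grid n (V w)) w) 0)))%:E)%E.
pose b n := (\int[P]_(w in D) (expR (- (psi eta * grid n (V w))))%:E)%E.
have ab n : (a n <= b n)%E.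
  rewrite /b -grid_laplace//; apply: ge0_le_integral => //.
  - exact: (measurableT_comp (mexpmax _)).
  - exact: (measurableT_comp (mexp _)).
  - by move=> w _; rewrite lee_fin max_le.
(* The error is r times the integral of exp (-eta0 X) at the grid time; by [grid_laplace] at eta0
   and psi(eta0) >= 0 that integral is at most 1, uniformly in n. *)
have ba n : (b n <= a n + r%:E)%E.
  rewrite /b -grid_laplace//.
  apply: (@le_trans _ _ (a n + r%:E *
      \int[P]_(w in D) (expR (- (eta0 * X (grid n (V w)) w)))%:E)%E).
    rewrite -ge0_integralZl//; last first.
      exact: (measurableT_comp (mexp _)).
    rewrite /a -ge0_integralD//; last 3 first.
      - exact: (measurableT_comp (mexpmax _)).
    - by move=> w _; rewrite mule_ge0// lee_fin// expR_ge0.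
    - by apply: measurable_funeM; exact: (measurableT_comp (mexp _)).
    apply: ge0_le_integral => //.
      - exact: (measurableT_comp (mexp _)).
    - apply: emeasurable_funD; first exact: (measurableT_comp (mexpmax _)).
      by apply: measurable_funeM; exact: (measurableT_comp (mexp _)).
    - by move=> w _; rewrite -EFinM -EFinD lee_fin le_maxD.
  rewrite leeD2l// -[leRHS]mule1 lee_pmul2l ?lte_fin//.
  rewrite grid_laplace//; apply: probability_integral_le1 => //.
    by apply/measurable_EFinP; exact: (measurableT_comp (mexp _)).
  move=> w Dw; rewrite expR_ge0/= -expR0 ler_expR oppr_le0 mulr_ge0//.
  by rewrite (le_trans Dw)// ltW// grid_gt.
have cexp (k : R) : continuous (fun x : R => expR (- (k * x))).
  move=> x; apply: continuous_comp; last exact: continuous_expR.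
  by apply: cvgN; apply: cvgMl_tmp; exact: cvg_id.
have ca : (a n @[n --> \oo] --> \int[P]_(w in D) (expR (- (eta * Num.max (Z w) 0)))%:E)%E.
  apply: (@cvg_dominated (fun x => expR (- (eta * Num.max x 0)))).
  - by apply/measurable_EFinP; exact: mexpmax.
  - move=> x; have cm : {for x, continuous (fun y : R => Num.max y 0)}.
      by apply: continuous_max; [exact: cvg_id|exact: cvg_cst].
    exact: (continuous_comp cm (cexp eta _)).
  - by move=> x; exact: expR_ge0.
  - exact: mX.
  - exact: measurable_funTS.
  - move=> n w _; rewrite -expR0 ler_expR oppr_le0 mulr_ge0 ?(ltW eta_gt0)//.
    by rewrite le_max lexx orbT.
  - by apply: filterS XZ.
have cb : (b n @[n --> \oo] --> \int[P]_(w in D) (expR (- (psi eta * V w)))%:E)%E.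
  apply: (@cvg_dominated (fun x => expR (- (psi eta * x)))).
  - by apply/measurable_EFinP; exact: mexp.
  - exact: cexp.
  - by move=> x; exact: expR_ge0.
  - exact: mG.
  - exact: measurable_funTS.
  - move=> n w Dw; rewrite -expR0 ler_expR oppr_le0 mulr_ge0//.
    by rewrite (le_trans Dw)// ltW// grid_gt.
  - by apply: aeW => w Dw; exact: cvg_grid.
apply/andP; split; last first.
  rewrite -(cvg_lim (@ereal_hausdorff R) ca) -(cvg_lim (@ereal_hausdorff R) cb).
  by apply: lee_lim; [exact: cvgP ca|exact: cvgP cb|exact: nearW].
rewrite leeBlDr//.
have ca' : ((a n + r%:E)%E @[n --> \oo] -->
    \int[P]_(w in D) (expR (- (eta * Num.max (Z w) 0)))%:E + r%:E)%E.
  by apply: cvgeD => //; [rewrite fin_num_adde_defl|exact: cvg_cst].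
rewrite -(cvg_lim (@ereal_hausdorff R) ca') -(cvg_lim (@ereal_hausdorff R) cb).
by apply: lee_lim; [exact: cvgP cb|exact: cvgP ca'|exact: nearW].
Qed.

End laplace_bounds.

(** * Laplace transforms and tails *)

Lemma integral_expRN_itv (R : realType) (eta q : R) : 0 < eta -> 0 < q ->
  (\int[lebesgue_measure]_(y in `]0%R, q[) (expR (- (eta * y)))%:E =
   ((1 - expR (- (eta * q))) / eta)%:E)%E.
Proof.
move=> eta0 q0.
have cF : continuous (fun x : R => - (expR (- (eta * x)) / eta)).
  move=> x; apply: cvgN; apply: cvgMr_tmp.
  apply: continuous_comp; last exact: continuous_expR.
  by apply: cvgN; apply: cvgMl_tmp; exact: cvg_id.
rewrite -(integral_itv_bndoo true false); last by apply/measurable_EFinP; exact: measurable_expRN_scale.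
rewrite (@continuous_FTC2 _ _ (fun x => - (expR (- (eta * x)) / eta)))//.
- by rewrite mulr0 oppr0 expR0 -EFinB; congr EFin; field; rewrite gt_eqF.
- apply: continuous_subspaceT => x; apply: continuous_comp; last exact: continuous_expR.
  by apply: cvgN; apply: cvgMl_tmp; exact: cvg_id.
- split.
  + move=> x _; exact: ex_derive.
  + exact/cvg_at_right_filter/cF.
  + exact/cvg_at_left_filter/cF.
- move=> x _; rewrite derive1E.
  have ? : is_derive x (1 : R) (fun x : R => - (expR (- (eta * x)) / eta)) (expR (- (eta * x))).
    apply: is_derive_eq; rewrite /GRing.scale/=; field; by rewrite gt_eqF.
  by rewrite derive_val.
Qed.

(** Tonelli on the region 0 < y < Q(w): the inner integral in y is that of exp (-eta y) from 0 to
    the positive part of Q(w). *)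
Lemma integral_tail (R : realType) d (T : measurableType d) (P : probability T R)
    (Q : {RV P >-> R}) (eta : R) : 0 < eta ->
  (\int[lebesgue_measure]_(y in `]0%R, +oo[) (expR (- (eta * y)) * fine (P [set w | (y < Q w)%R]))%:E =
   \int[P]_w ((1 - expR (- (eta * Num.max (Q w) 0))) / eta)%:E)%E.
Proof.
move=> eta0.
pose GR := measurableTypeR R.
pose f (p : T * GR) : \bar R := (\1_[set y : R | 0 < y < Q p.1] p.2 * expR (- (eta * p.2)))%:E.
have f0 p : (0 <= f p)%E by rewrite lee_fin mulr_ge0 ?expR_ge0// indicE.
have mf : measurable_fun setT f.
  apply/measurable_EFinP; apply: measurable_funM; last first.
    exact: (measurableT_comp (@measurable_expRN_scale _ eta setT)).
  rewrite (_ : (fun p : T * GR => \1_[set y : R | 0 < y < Q p.1] p.2) =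
    \1_[set p : T * GR | (0 < p.2 < Q p.1)%R]); last first.
    by apply/funext => p; rewrite !indicE; congr (_%:R); apply/idP/idP; rewrite !inE.
  apply: measurable_indic.
  have m1 : measurable_fun setT (fun p : T * GR => 0 < p.2) by exact: measurable_fun_ltr.
  have m2 : measurable_fun setT (fun p : T * GR => p.2 < Q p.1).
    apply: measurable_fun_ltr => //; exact: measurableT_comp.
  rewrite (_ : mkset _ = (fun p : T * GR => 0 < p.2) @^-1` [set true] `&`
     (fun p : T * GR => p.2 < Q p.1) @^-1` [set true]); last first.
    by apply/seteqP; split => p /= => [/andP[]|[-> ->]].
  by apply: measurableI; rewrite -[X in measurable X]setTI; [exact: m1|exact: m2].
transitivity (\int[lebesgue_measure]_(y in [set: GR]) \int[P]_w f (w, y))%E.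
  rewrite integral_mkcond; apply: eq_integral => y _.
  have fE w : f (w, y) = ((expR (- (eta * y)))%:E *
      (\1_[set w | 0 < y < Q w] w)%:E)%E.
    rewrite /f/= -EFinM mulrC !indicE; congr ((_ * (nat_of_bool _)%:R)%:E).
  under eq_integral do rewrite fE.
  rewrite patchE; case: ifPn => [|].
    rewrite inE/= in_itv/= andbT => y0.
    have Qy : [set w | 0 < y < Q w] = [set w | y < Q w].
      by apply/seteqP; split => w /=; rewrite y0.
    have mQy : measurable [set w | y < Q w].
      rewrite (_ : [set w | _] = Q @^-1` `]y, +oo[%classic); first exact: measurable_funPTI.
      by apply/seteqP; split => w /=; rewrite in_itv/= andbT.
    rewrite Qy ge0_integralZl//; last first.
      by apply/measurable_EFinP; exact: measurable_indic.
    by rewrite integral_indic// setIT EFinM fineK// fin_num_measure.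
  rewrite notin_setE/= in_itv/= andbT => /negP y0.
  rewrite integral0_eq// => w _; rewrite indicE memNset ?mule0//=.
  by rewrite (negbTE y0).
rewrite -fubini_tonelli//.
apply: eq_integral => w _.
have [Q0|Q0] := ltP 0 (Q w).
  rewrite -integral_expRN_itv// [RHS]integral_mkcond.
  apply: eq_integral => y _; rewrite /f/= patchE indicE.
  rewrite set_itvoo.
  by case: ifPn => _; rewrite ?mul1r ?mul0r.
rewrite mulr0 oppr0 expR0 subrr mul0r integral0_eq// => y _.
rewrite /f/= indicE memNset ?mul0r//= => /andP[y0 yQ].
by move: (lt_trans y0 yQ); rewrite ltNge Q0.
Qed.

(** * Subordination *)

Lemma expR_moments_ae_eq0 d (T : measurableType d) (R : realType) (P : probability T R)
    (X : {RV P >-> R}) (a : R) : a != 0 ->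
  (\int[P]_w (expR (a * X w))%:E = 1)%E ->
  (\int[P]_w (expR (2 * a * X w))%:E = 1)%E -> {ae P, forall w, X w = 0}.
Proof.
move=> a0 E1 E2.
have mX (b : R) : measurable_fun setT (fun w => expR (b * X w)).
  by apply: measurableT_comp => //; apply: measurable_funM.
(* [E (exp (a X) - 1)^2 = 0] *)
pose f w := (expR (a * X w) - 1) ^+ 2.
have mf : measurable_fun setT (fun w => (f w)%:E).
  by apply/measurable_EFinP; apply: measurable_funX; apply: measurable_funB.
have f0 w : 0 <= f w by exact: sqr_ge0.
have If : (\int[P]_w (f w)%:E = 0)%E.
  (* The square is expanded with sums on both sides, so that additivity for nonnegative functions
     applies before the integral of [f] is known to be finite. *)
  have : (\int[P]_w ((expR (2 * a * X w))%:E + 1) =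
          \int[P]_w ((f w)%:E + 2%:E * (expR (a * X w))%:E))%E.
    apply: eq_integral => w _; rewrite -EFinM -!EFinD; congr EFin.
    by rewrite /f (_ : 2 * a * X w = a * X w + a * X w) ?expRD; ring.
  have me (b : R) : measurable_fun setT (fun w => (expR (b * X w))%:E).
    exact/measurable_EFinP.
  have I1 : (\int[P]_(_ in [set: T]) (1 : \bar R) = 1)%E.
    rewrite (@integral_cst _ _ _ P setT measurableT 1%E).
    by rewrite mul1e; exact: probability_setT.
  rewrite !ge0_integralD//; last 2 first.
  - by move=> w _; rewrite lee_fin.
  - exact: measurable_funeM.
  rewrite ge0_integralZl// E1 E2 I1 mule1.
  by case: (\int[P]_w (f w)%:E)%E => [r||]//; rewrite -!EFinD => -[] ?; congr EFin; lra.
have : (\int[P]_(w in setT) `|(f w)%:E| = 0)%E.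
  by rewrite -[RHS]If; apply: eq_integral => w _; rewrite gee0_abs ?lee_fin.
move=> /(ae_eq_integral_abs P measurableT mf).
apply: filterS => w /(_ I) [] /eqP; rewrite sqrf_eq0 subr_eq0 => /eqP.
rewrite -[RHS]expR0 => /expR_inj /eqP; rewrite mulf_eq0 (negbTE a0)/= => /eqP.
by [].
Qed.

Section subordination.
Context d (T : measurableType d) (R : realType) (P : probability T R).
Variables (Y S Q : R -> {RV P >-> R}).
Hypothesis levyY : levy_process Y.
Hypothesis S0 : {ae P, forall w, S 0 w = 0}.
Hypothesis Smono : {ae P, forall w, forall s t : R, 0 <= s -> s <= t -> S s w <= S t w}.
Hypothesis YS : independent_processes Y S.
Hypothesis YSQ : subordinated_process Y S Q.

Lemma subordinator_ge0 t : 0 <= t -> {ae P, forall w, 0 <= S t w}.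
Proof.
move=> t0; apply: filterS2 S0 Smono => w Sw0 Sm.
by rewrite -[leLHS]Sw0; exact: Sm.
Qed.

Lemma cvg_subordinated_grid t : 0 <= t ->
  {ae P, forall w, Y (grid n (S t w)) w @[n --> \oo] --> Q t w}.
Proof.
move=> t0; have [_ _ _ Ycadlag] := levyY.
apply: filterS3 (subordinator_ge0 t0) Ycadlag (YSQ t0) => w Sw [Yr _] ->.
exact: (@cvg_right_grid _ _ (fun s => Y s w) _ Sw (Yr _ Sw)).
Qed.

Lemma independent_preimages t s B C : 0 <= t -> 0 <= s -> measurable B -> measurable C ->
  P (S t @^-1` C `&` Y s @^-1` B) = (P (S t @^-1` C) * P (Y s @^-1` B))%E.
Proof.
move=> t0 s0 mB mC; rewrite setIC muleC; apply: YS; apply: sub_sigma_algebra.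
  by exists s; exists B.
by exists t; exists C.
Qed.

Lemma subordinated_time0 : {ae P, forall w, Q 0 w = 0}.
Proof.
have [Y0 _ _ _] := levyY.
by apply: filterS3 Y0 S0 (YSQ (lexx 0)) => w Yw -> ->.
Qed.

(** The null set on which Y(s) differs from 0 depends on s, but the approximation only visits the
    countably many grid times; right-continuity does the rest. *)
Lemma subordinated_ae_eq0 t : 0 <= t -> (forall s, 0 <= s -> {ae P, forall w, Y s w = 0}) ->
  {ae P, forall w, Q t w = 0}.
Proof.
move=> t0 Y0.
have Y0' : {ae P, forall w, forall n k : nat, Y (k.+1%:R / n.+1%:R) w = 0}.
  by do 2 apply: ae_foralln => ?; apply: Y0; rewrite divr_ge0.
apply: filterS2 Y0' (cvg_subordinated_grid t0) => w Yw.
under eq_cvg do rewrite /grid Yw.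
by move=> /cvg_lim <-//; rewrite lim_cst.
Qed.

End subordination.

(** * Behaviour of the exponents at 0 *)

(** The normalization alpha / eps^alpha turns (z eps)^alpha / alpha into z^alpha, so the InG
    exponent is equivalent to z^alpha at 0. *)
Lemma InG_exponent_bounds (R : realType) (alpha eps z : R) :
  0 < alpha -> 0 < eps -> 0 < z ->
  z `^ alpha * expR (- (z * eps)) <=
    alpha / eps `^ alpha * lower_incomplete_gamma alpha (z * eps) <= z `^ alpha.
Proof.
move=> a0 e0 z0; have ze0 : 0 < z * eps by exact: mulr_gt0.
have ea0 : 0 < eps `^ alpha by exact: powR_gt0.
have k0 : 0 < alpha / eps `^ alpha by exact: divr_gt0.
have /andP[g1 g2] := lower_incomplete_gamma_bounds a0 ze0.
have E : alpha / eps `^ alpha * ((z * eps) `^ alpha / alpha) = z `^ alpha.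
  by rewrite powRM ?(ltW z0) ?(ltW e0)//; field; rewrite !gt_eqF.
apply/andP; split; last by rewrite -[leRHS]E ler_pM2l.
by rewrite -E -mulrA [X in _ * X]mulrC ler_pM2l.
Qed.

(** Both sides are instances of 1 + y <= exp y, at y = x and at y = -x. *)
Lemma oneBexpRN_bounds (R : realType) (x : R) :
  x * expR (- x) <= 1 - expR (- x) <= x.
Proof.
apply/andP; split; last by have := expR_ge1Dx (- x); lra.
have : expR (- x) * (1 + x) <= expR (- x) * expR x by rewrite ler_wpM2l ?expR_ge0// expR_ge1Dx.
rewrite -expRD addNr expR0; lra.
Qed.

Section psi_asymptotics.
Variables (R : realType) (psi : R -> R) (alpha beta k : R).
Hypotheses (alpha0 : 0 < alpha) (beta0 : 0 < beta).
Hypothesis psi_asymp : asymp_equiv (0^'+) (fun eta => psi eta `^ alpha / eta)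
                     (fun eta => k * eta `^ (beta - 1)).

(** When k = 0 the reference function vanishes identically, so the conventional ratio is 1 where
    psi(eta)^alpha = 0 and 0 elsewhere; being within distance less than 1 of 1, it must be 1. *)
Lemma asymp_equiv0_near0 : k = 0 -> \forall eta \near 0^'+, psi eta = 0.
Proof.
move=> k0; have h2 : (0 : R) < 1 by [].
have := psi_asymp; rewrite /asymp_equiv => /cvgrPdist_lt /(_ _ h2) h.
near=> eta.
have eta0 : 0 < eta by near: eta; exact: nbhs_right_gt.
have : `|1 - (if (psi eta `^ alpha / eta == 0) && (k * eta `^ (beta - 1) == 0) then 1
  else psi eta `^ alpha / eta / (k * eta `^ (beta - 1)))| < 1 by near: eta.
rewrite k0 mul0r eqxx andbT invr0 mulr0.
case: ifPn => [|_]; last by rewrite subr0 normr1 ltxx.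
rewrite mulf_eq0 invr_eq0 (gt_eqF eta0) orbF powR_eq0 => /andP[/eqP-> _] //.
Unshelve. all: by end_near. Qed.

Hypothesis k_gt0 : 0 < k.

Lemma asymp_equiv_powR_cvg : psi eta `^ alpha * eta `^ (- beta) @[eta --> 0^'+] --> k.
Proof.
have h : k * (if (psi eta `^ alpha / eta == 0) && (k * eta `^ (beta - 1) == 0) then 1
    else psi eta `^ alpha / eta / (k * eta `^ (beta - 1))) @[eta --> 0^'+] --> k.
  by rewrite -[X in _ --> X]mulr1; exact: cvgMl_tmp psi_asymp.
apply: cvg_trans h; apply: near_eq_cvg; near=> eta.
have eta0 : 0 < eta by near: eta; exact: nbhs_right_gt.
have ne0 : k * eta `^ (beta - 1) != 0 by rewrite gt_eqF// mulr_gt0// powR_gt0.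
rewrite (negbTE ne0) andbF (_ : beta - 1 = - (1 - beta)); last by ring.
rewrite !powRN powRB ?(gt_eqF eta0) ?implybT// powRr1 ?(ltW eta0)//.
field; by rewrite !gt_eqF// powR_gt0.
Unshelve. all: by end_near. Qed.

Lemma psi_powR_cvg0 : psi eta `^ alpha @[eta --> 0^'+] --> (0 : R).
Proof.
have h : psi eta `^ alpha * eta `^ (- beta) * eta `^ beta @[eta --> 0^'+] --> (0 : R).
  by rewrite -[X in _ --> X](mulr0 k); apply: cvgM; [exact: asymp_equiv_powR_cvg|exact: powR_cvg0].
apply: cvg_trans h; apply: near_eq_cvg; near=> eta.
have eta0 : 0 < eta by near: eta; exact: nbhs_right_gt.
by rewrite /= powRN divfK// gt_eqF// powR_gt0.
Unshelve. all: by end_near. Qed.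

(* [powR] is 1 on negative bases, so [psi eta < 0] would contradict [psi_powR_cvg0]. *)
Lemma psi_near_gt0 : \forall eta \near 0^'+, 0 < psi eta.
Proof.
have := psi_powR_cvg0 => /cvgr0_norm_lt /(_ 1 ltr01) h1.
have := asymp_equiv_powR_cvg => /cvgr_gt /(_ _ k_gt0) h2.
near=> eta.
have : `|psi eta `^ alpha| < 1 by near: eta.
have : 0 < psi eta `^ alpha * eta `^ (- beta) by near: eta.
have [//|p|<-] := ltgtP 0 (psi eta); first by rewrite lt0_powR1// normr1 ltxx.
by rewrite powR0 ?gt_eqF// mul0r ltxx.
Unshelve. all: by end_near. Qed.

(** Where psi is positive [powR] is the usual power, and its monotonicity transfers the convergence
    of psi^alpha to psi. *)
Lemma psi_cvg0 : psi eta @[eta --> 0^'+] --> (0 : R).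
Proof.
apply/cvgr0Pnorm_lt => e e0; have ea0 : 0 < e `^ alpha by exact: powR_gt0.
have := psi_powR_cvg0 => /cvgr0_norm_lt /(_ _ ea0) h1.
have h2 := psi_near_gt0.
near=> eta.
have p0 : 0 < psi eta by near: eta.
have : `|psi eta `^ alpha| < e `^ alpha by near: eta.
rewrite !ger0_norm ?powR_ge0 ?(ltW p0)//; apply: contraTT; rewrite -!leNgt => ep.
by apply: (ge0_ler_powR (ltW alpha0)) => //; rewrite nnegrE ltW.
Unshelve. all: by end_near. Qed.

End psi_asymptotics.

(** * The tail function and its Laplace transform *)

Section tail.
Context d (T : measurableType d) (R : realType) (P : probability T R).
Variable Q : {RV P >-> R}.

Lemma integrable_laplace_pos (eta : R) : 0 < eta ->
  P.-integrable setT (fun w => (expR (- (eta * Num.max (Q w) 0)))%:E).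
Proof.
move=> eta0.
have m : measurable_fun setT (fun w => (expR (- (eta * Num.max (Q w) 0)))%:E).
  apply/measurable_EFinP; apply: measurableT_comp => //; apply: measurableT_comp => //.
  by apply: measurable_funM => //; exact: measurable_maxr.
apply: (le_integrable measurableT m _ (finite_measure_integrable_cst P 1 measurableT)).
move=> w _; rewrite /= normr1 lee_fin ger0_norm ?expR_ge0//.
by rewrite -expR0 ler_expR oppr_le0 mulr_ge0 ?(ltW eta0)// le_max lexx orbT.
Qed.

Lemma laplace_tail_integral (eta : R) : 0 < eta ->
  (\int[lebesgue_measure]_(y in `]0%R, +oo[)
     (expR (- (eta * y)) * fine (P [set w | (y < Q w)%R]))%:E =
   ((1 - \int[P]_w expR (- (eta * Num.max (Q w) 0))) / eta)%:E)%E.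
Proof.
move=> eta0; rewrite integral_tail//.
have iL := integrable_laplace_pos eta0.
have fL := integrable_fin_num measurableT iL.
have i1 := finite_measure_integrable_cst P (1 : R) measurableT.
transitivity (\int[P]_w ((eta^-1)%:E * ((cst 1%E \- (fun w => (expR (- (eta * Num.max (Q w) 0)))%:E)) w)))%E.
  by apply: eq_integral => w _; rewrite /= -EFinB -EFinM mulrC.
rewrite integralZl//; last exact: integrableB.
have I1 : (\int[P]_w cst 1%E w = 1)%E.
  by rewrite (@integral_cst _ _ _ P setT measurableT 1%E) mul1e; exact: probability_setT.
rewrite integralB// [X in (_ * (X - _))%E]I1.
by rewrite /Rintegral -(fineK fL) -EFinB -EFinM mulrC.
Qed.

Lemma tail_nonincreasing (x y : R) : x <= y ->
  fine (P [set w | y < Q w]) <= fine (P [set w | x < Q w]).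
Proof.
move=> xy.
have m z : measurable [set w | z < Q w].
  rewrite (_ : [set w | _] = Q @^-1` `]z, +oo[%classic); first exact: measurable_funPTI.
  by apply/seteqP; split => w /=; rewrite in_itv/= andbT.
apply: fine_le; [exact: fin_num_measure|exact: fin_num_measure|].
by apply: le_measure; rewrite ?inE// => w /=; exact: le_lt_trans.
Qed.

Lemma tail_laplace_integrable : laplace_integrable (fun y => fine (P [set w | y < Q w])).
Proof.
move=> eta eta0; apply/integrableP; split.
  apply/measurable_EFinP; apply: measurable_funM; first exact: measurable_expRN_scale.
  by apply: nonincreasing_measurable => // x y xy; exact: tail_nonincreasing.
under eq_integral do rewrite gee0_abs ?lee_fin ?mulr_ge0 ?expR_ge0 ?fine_ge0//.
by rewrite laplace_tail_integral// ltry.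
Qed.

(** Degenerate case: for x > 0 both functions vanish, and the ratio is 1 by convention. *)
Lemma asymp_equiv_tail0 (h : R -> R) : {ae P, forall w, Q w = 0} ->
  (forall x, h x = 0) -> asymp_equiv (+oo) (fun x => fine (P [set w | x < Q w])) h.
Proof.
move=> Q0 h0; rewrite /asymp_equiv.
have c1 : (fun _ : R => 1 : R) @ +oo --> (1 : R) by exact: cvg_cst.
apply: cvg_trans c1; apply: near_eq_cvg; near=> x.
have x0 : 0 < x by [].
suff -> : P [set w | x < Q w] = 0%E by rewrite h0 /= eqxx.
apply: measure_negligible.
  rewrite (_ : [set w | _] = Q @^-1` `]x, +oo[%classic); first exact: measurable_funPTI.
  by apply/seteqP; split => w /=; rewrite in_itv/= andbT.
apply: negligibleS Q0 => w /= xQ Qw; move: xQ; rewrite Qw.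
by rewrite ltNge ltW.
Unshelve. all: by end_near. Qed.

End tail.

(** * From the Laplace exponents to the tail of the subordinated process *)

Unset Implicit Arguments.

Theorem theorem3p7 (R : realType) (d : measure_display) (T : measurableType d)
    (P : probability T R) (Y S Q : R -> {RV P >-> R}) (psi : R -> R)
    (alpha eps c beta : R) :
  levy_process Y -> laplace_exponent Y psi ->
  0 < alpha < 1 -> 0 < eps ->
  InG_subordinator alpha eps S ->
  independent_processes Y S ->
  subordinated_process Y S Q ->
  0 < beta < 1 ->
  asymp_equiv (0^'+) (fun eta => psi eta `^ alpha / eta)
                     (fun eta => c `^ alpha * eta `^ (beta - 1)) ->
  forall t : R, 0 <= t ->
    asymp_equiv (+oo) (fun x => fine (P [set w | x < Q t w]))
                (fun x => c `^ alpha * t * x `^ (- beta) / Gamma (1 - beta)).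
Proof.
move=> levyY lapY /andP[alpha0 alpha1] eps0 [levyS Smono lapS] YS YSQ b01 psiE t t0.
have /andP[beta0 beta1] := b01.
have S0 : {ae P, forall w, S 0 w = 0} by case: levyS.
have Ypsi s eta : 0 <= s -> 0 < eta ->
    (\int[P]_w (expR (- (eta * Y s w)))%:E = (expR (- (s * psi eta)))%:E)%E.
  by move=> s0 eta0; have := lapY s eta s0 eta0; rewrite unlock.
(* [powR] is never negative, whatever the sign of [c], so c^alpha is either 0 or positive. *)
have [k0|k0] := eqVneq (c `^ alpha) 0.
  (* [psi] vanishes near 0, which forces [Y = 0]. *)
  apply: asymp_equiv_tail0 => [|x]; last by rewrite k0 !mul0r.
  apply: (subordinated_ae_eq0 levyY S0 Smono YSQ t0) => s s0.
  have [e /= e0 psi0] := asymp_equiv0_near0 psiE k0.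
  have psi_e eta : 0 < eta < e -> psi eta = 0.
    move=> /andP[eta0 eta1]; apply: psi0 => //=.
    by rewrite sub0r normrN gtr0_norm.
  (* Both e/4 and its double lie in the range where psi vanishes, so exp (-(e/4) Y(s)) has first and
     second moments equal to 1. *)
  have a0 : 0 < e / 4 by rewrite divr_gt0.
  apply: (@expR_moments_ae_eq0 _ _ _ _ _ (- (e / 4))); first by rewrite oppr_eq0 gt_eqF.
    under eq_integral do rewrite mulNr.
    by rewrite Ypsi// psi_e ?mulr0 ?oppr0 ?expR0// a0/=; lra.
  under eq_integral do rewrite mulrN mulNr.
  rewrite Ypsi ?mulr_gt0// psi_e ?mulr0 ?oppr0 ?expR0// mulr_gt0//=; lra.
have k_gt0 : 0 < c `^ alpha by rewrite lt_neqAle eq_sym k0 powR_ge0.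
(* At t = 0 both sides degenerate; the Tauberian theorem is reserved for t c^alpha > 0. *)
have [->|t_neq0] := eqVneq t 0.
  apply: asymp_equiv_tail0 => [|x]; last by rewrite mulr0 !mul0r.
  exact: (subordinated_time0 levyY S0 YSQ).
have {t_neq0} t_gt0 : 0 < t by rewrite lt_neqAle eq_sym t_neq0.
set k := c `^ alpha in k0 k_gt0 psiE *.
have Spsi z : 0 < z -> (\int[P]_w (expR (- (z * S t w)))%:E =
    (expR (- (t * (alpha / eps `^ alpha * lower_incomplete_gamma alpha (z * eps)))))%:E)%E.
  by move=> z0; have := lapS t z t0 z0; rewrite unlock.
pose G x := fine (P [set w | x < Q t w]).
have tk0 : 0 < t * k by exact: mulr_gt0.
have iG : laplace_integrable G by exact: tail_laplace_integrable.
have Gcvg : eta `^ (1 - beta) *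
    \int[lebesgue_measure]_(y in `]0, +oo[) (expR (- (eta * y)) * G y)
    @[eta --> 0^'+] --> t * k.
  have ucvg := asymp_equiv_powR_cvg psiE k_gt0.
  have pacvg := psi_powR_cvg0 beta0 psiE k_gt0.
  have pcvg := psi_cvg0 alpha0 beta0 psiE k_gt0.
  have [e /= e0 ppos] := psi_near_gt0 alpha0 beta0 psiE k_gt0.
  have psi_gt0 eta : 0 < eta < e -> 0 < psi eta.
    move=> /andP[eta0 eta1]; apply: ppos => //=.
    by rewrite sub0r normrN gtr0_norm.
  (* A fixed reference point for the convexity bound, inside the range where psi > 0. *)
  pose eta1 := e / 2; have eta1_gt0 : 0 < eta1 by rewrite divr_gt0.
  have eta1_lt : eta1 < e by rewrite /eta1; lra.
  (* [lo] combines x exp (-x) <= 1 - exp (-x) with the lower bound on the InG exponent. The last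
     term of [hi] is eta^(-beta) times the negative-part error eta / eta1, and tends to 0 because
     beta < 1. *)
  pose lo eta := t * (psi eta `^ alpha * eta `^ (- beta)) *
    (expR (- (psi eta * eps)) * expR (- (t * psi eta `^ alpha))).
  pose hi eta := t * (psi eta `^ alpha * eta `^ (- beta)) + eta `^ (1 - beta) / eta1.
  have cvg_exp0 (f : R -> R) : f eta @[eta --> 0^'+] --> (0 : R) ->
      expR (- f eta) @[eta --> 0^'+] --> (1 : R).
    move=> f0; rewrite [X in _ --> X](_ : _ = expR (- 0)); last by rewrite oppr0 expR0.
    apply: continuous_cvg; first exact: continuous_expR.
    exact: cvgN.
  apply: (@squeeze_cvgr _ _ _ _ lo hi).
  - near=> eta.
    have eta_gt0 : 0 < eta by near: eta; exact: nbhs_right_gt.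
    have eta_le : eta <= eta1 by near: eta; exact: nbhs_right_le.
    have p0 : 0 < psi eta by apply: psi_gt0; rewrite eta_gt0 (le_lt_trans eta_le).
    have p10 : 0 < psi eta1 by apply: psi_gt0; rewrite eta1_gt0.
    have eta01 : 0 < eta <= eta1 by rewrite eta_gt0.
    have := laplace_positive_part_bounds
      (fun s B C s0 mB mC => independent_preimages YS t0 s0 mB mC)
      Ypsi (subordinator_ge0 S0 Smono t0)
      (cvg_subordinated_grid levyY S0 Smono YSQ t0)
      eta01 (ltW p0) (ltW p10).
    have fL := integrable_fin_num measurableT (integrable_laplace_pos (Q t) eta_gt0).
    rewrite Spsi// -(fineK fL) -EFinB !lee_fin.
    have -> : \int[lebesgue_measure]_(y in `]0, +oo[) (expR (- (eta * y)) * G y) =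
        (1 - \int[P]_w expR (- (eta * Num.max (Q t w) 0))) / eta.
      exact: (congr1 fine (laplace_tail_integral (Q t) eta_gt0)).
    rewrite -/(Rintegral P setT (fun w => expR (- (eta * Num.max (Q t w) 0)))).
    (* Only real estimates remain: [L] is E exp (-eta max(Q(t), 0)), and [g] will be the InG
       exponent at psi(eta). *)
    move: (Rintegral P _ _) => L.
    have := InG_exponent_bounds alpha0 eps0 p0.
    move: (alpha / _ * _) => g /andP[g1 g2].
    have /andP[x1 x2] := oneBexpRN_bounds (t * g).
    move=> /andP[L1 L2].
    have eb : 0 < eta `^ (- beta) by exact: powR_gt0.
    rewrite (_ : eta `^ (1 - beta) * ((1 - L) / eta) = eta `^ (- beta) * (1 - L)); last first.
      by rewrite powRD ?(gt_eqF eta_gt0) ?implybT// powRr1 ?(ltW eta_gt0)//; field; rewrite gt_eqF.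
    have pa0 : 0 <= psi eta `^ alpha by exact: powR_ge0.
    apply/andP; split.
      rewrite /lo (_ : t * _ * _ = eta `^ (- beta) * (t * (psi eta `^ alpha *
        expR (- (psi eta * eps))) * expR (- (t * psi eta `^ alpha)))); last by ring.
      rewrite ler_pM2l// (le_trans _ (_ : 1 - expR (- (t * g)) <= _))//; last by lra.
      apply: le_trans x1; apply: ler_pM.
      - by rewrite !mulr_ge0 ?expR_ge0 ?(ltW t_gt0).
      - exact: expR_ge0.
      - by rewrite ler_pM2l.
      - by rewrite ler_expR lerN2 ler_pM2l.
    rewrite /hi (_ : eta `^ (1 - beta) / eta1 = eta `^ (- beta) * (eta / eta1)); last first.
      by rewrite powRD ?(gt_eqF eta_gt0) ?implybT// powRr1 ?(ltW eta_gt0)//; field; rewrite gt_eqF.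
    rewrite (_ : t * _ + _ = eta `^ (- beta) * (t * psi eta `^ alpha + eta / eta1)); last by ring.
    rewrite ler_pM2l//.
    have : t * g <= t * psi eta `^ alpha by rewrite ler_pM2l.
    lra.
  - rewrite [X in _ --> X](_ : _ = t * k * (1 * 1)); last by rewrite !mulr1.
    apply: cvgM; first exact: cvgMl_tmp.
    apply: cvgM; apply: cvg_exp0.
      by rewrite -[X in _ --> X](mul0r eps); exact: cvgMr_tmp.
    by rewrite -[X in _ --> X](mulr0 t); exact: cvgMl_tmp.
  - rewrite [X in _ --> X](_ : _ = t * k + 0 / eta1); last by rewrite mul0r addr0.
    apply: cvgD; first exact: cvgMl_tmp.
    by apply: cvgMr_tmp; apply: powR_cvg0; rewrite subr_gt0.
have Kcvg := karamata_monotone b01 tk0 iG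
  (fun y _ => fine_ge0 (measure_ge0 P _)) (fun x y _ xy => tail_nonincreasing (Q t) xy) Gcvg.
have a01 : 0 < 1 - beta <= 1 by rewrite subr_gt0 beta1/= gerBl ltW.
have Ga0 := Gamma_gt0 a01.
have lim0 : 0 < t * k / Gamma (1 - beta) by exact: divr_gt0.
rewrite /asymp_equiv.
have h : (t * k / Gamma (1 - beta))^-1 * (G x * x `^ beta) @[x --> +oo] --> (1 : R).
  have lim_neq0 : t * k / Gamma (1 - beta) != 0 by rewrite gt_eqF.
  rewrite -[X in _ --> X](mulVf lim_neq0).
  exact: cvgMl_tmp Kcvg.
apply: cvg_trans h; apply: near_eq_cvg; near=> x.
have x0 : 0 < x by [].
have xb0 : 0 < x `^ beta by exact: powR_gt0.
rewrite powRN; set g := k * t * _ / _.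
(* The denominator is nonzero for every x > 0, so the ratio is an ordinary quotient here. *)
have g0 : g != 0 by rewrite gt_eqF// divr_gt0// !mulr_gt0// invr_gt0.
rewrite (negbTE g0) andbF /g -/(G x); field.
by rewrite !gt_eqF.
Unshelve. all: by end_near. Qed.
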